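(* For $A$ ranging over the category $\mathcal{PMV}_f$ and $(R,u)$ ranging over the category $\mathcal{LR}_u$, the isomorphisms $A\to\Gamma(A^\sharp,u)$, $a\mapsto (0,\widehat a)$, and $\tau_R:\Gamma(R,u)^\sharp\to (R,u)$, $\tau_R\big(\sum_{i=1}^n\epsilon_i(0,\widehat{x_i})\big)=\sum_{i=1}^n\epsilon_i x_i$ (with $x_i\in\Gamma(R,u)$, $\epsilon_i\in\{-1,1\}$), are natural transformations (from the identity functor of $\mathcal{PMV}_f$ to $A\mapsto \Gamma(A^\sharp,u)$, and from $(R,u)\mapsto\Gamma(R,u)^\sharp$ to the identity functor of $\mathcal{LR}_u$, respectively).
   Context: **MV-algebras.** An MV-algebra is $(A,\oplus,\neg,0)$ with $(A,\oplus,0)$ a commutative monoid, $\neg\neg x=x$, $x\oplus\neg 0=\neg 0$, $\neg(\neg x\oplus y)\oplus y=\neg(\neg y\oplus x)\oplus x$. Put $u=\neg 0$, $x\odot y=\neg(\neg x\oplus\neg y)$, $x\ominus y=\neg(\neg x\oplus y)$; the lattice order is $x\le y\iff x\ominus y=0$. An ideal is a nonempty down-closed subset closed under $\oplus$; an ideal $P$ is prime if $a\wedge b\in P$ implies $a\in P$ or $b\in P$; $Spec(A)$ is the set of prime ideals. For an ideal $I$, $A/I$ is the quotient by $x\equiv_I y\iff (x\ominus y)\oplus(y\ominus x)\in I$, with classes $[x]_I$. **$\mathcal{PMV}_f$.** All products are commutative. A $PMV_f$-algebra is an MV-algebra with an associative commutative product $\cdot$ such that for all $a,b,c$: $a0=0$;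 $a(b\oplus c)\le ab\oplus ac$; $ab\le a\wedge b$; $a(b\ominus c)=ab\ominus ac$. Homomorphisms are MV-homomorphisms preserving the product; $\mathcal{PMV}_f$ is the resulting category. A $PMV_f$-chain is a totally ordered $PMV_f$-algebra. For a $PMV_f$-algebra $A$ every ideal $I$ of the underlying MV-algebra is closed under multiplication by elements of $A$, and $A/I$ is a $PMV_f$-algebra, totally ordered if $I$ is prime. **$\mathcal{LR}_u$.** All rings are commutative and associative (not necessarily with a multiplicative identity). An $l$-ring is a ring whose additive group is a lattice-ordered abelian group and in which $x,y\ge0$ implies $xy\ge 0$. An $l_u$-ring $(R,u)$ is an $l$-ring with a distinguished strong unit $u\ge 0$: for each $x\in R$ there is an integer $n\ge0$ with $|x|\le nu$. It is semi-low if $ab\le a\wedge b$ for all $a,b\in[0,u]$. $\mathcal{LR}_u$ is the category of semi-low $l_u$-rings with ring homomorphisms that preserve the lattice operations and the strong unit. **$\Gamma$.** $\Gamma(R,u)=\{x\in R: 0\le x\le u\}$ with $x\oplus y=(x+y)\wedge u$, $\neg x=u-x$, and product inherited from $R$; on morphisms $\Gamma(\varphi)=\varphi|_{[0,u]}$. **$A^\sharp$ for chains.** For a $PMV_f$-chain $A$, $A^\sharp$ is $\mathbb Z\times A$ with the identification $(m+1,0)=(m,u)$, addition $(m,a)+(n,b)=(m+n,a\oplus b)$ if $a\oplus b\ne u$ and $(m+n+1,a\odot b)$ if $a\oplus b=u$, negatives $-(m,a)=(-m-1,\neg a)$, lexicographic order (on representatives with second entry $\neq u$), strong unit $(0,u)=(1,0)$,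 and product $(m,a)(n,b)=mn(0,u^2)+m(0,bu)+n(0,au)+(0,ab)$. **$A^\sharp$ in general.** For a $PMV_f$-algebra $A$ and $a\in A$ let $(0,\widehat a)\in\prod_{P\in Spec(A)}(A/P)^\sharp$ be the element whose $P$-component is $(0,[a]_P)$. Then $A^\sharp$ is the sub-$l$-ring of this product generated by $\{(0,\widehat a):a\in A\}$, with strong unit $(0,\widehat u)$; every element of $A^\sharp$ is of the form $\sum_{i}\epsilon_i(0,\widehat{a_i})$ with $\epsilon_i\in\{-1,1\}$, $a_i\in A$. For a homomorphism $h:A\to B$ of $PMV_f$-algebras, $h^\sharp\big(\sum_i\epsilon_i(0,\widehat{a_i})\big)=\sum_i\epsilon_i(0,\widehat{h(a_i)})$. *)

(* Defs.v *)
From mathcomp Require Import all_boot all_order all_algebra.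
From mathcomp Require Import boolp classical_sets.
From Stdlib Require Relations.Relation_Operators.

Set Implicit Arguments.
Unset Strict Implicit.
Unset Printing Implicit Defensive.

Record category := Category {
  obj :> Type;
  arr : obj -> obj -> Type;
  idm : forall X, arr X X;
  ccomp : forall X Y Z, arr Y Z -> arr X Y -> arr X Z;
  comp_idl : forall X Y (f : arr X Y), ccomp (idm Y) f = f;
  comp_idr : forall X Y (f : arr X Y), ccomp f (idm X) = f;
  comp_assoc : forall X Y Z W (f : arr Z W) (g : arr Y Z) (h : arr X Y),
    ccomp f (ccomp g h) = ccomp (ccomp f g) h }.

(* The action on objects is a parameter of [functor], so that a functor with a
   prescribed action on objects can be spoken of. *)
Record functor (C D : category) (F : C -> D) := Functor {
  fmap : forall X Y : C, arr X Y -> arr (F X) (F Y);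
  fmap_id : forall X : C, fmap (idm X) = idm (F X);
  fmap_comp : forall (X Y Z : C) (f : arr Y Z) (g : arr X Y),
    fmap (ccomp f g) = ccomp (fmap f) (fmap g) }.

Definition functor_id (C : category) : @functor C C (fun X => X) :=
  @Functor C C (fun X => X) (fun X Y f => f)
    (fun X => erefl) (fun X Y Z f g => erefl).

Lemma functor_comp_id (C D E : category) (G : D -> E) (F : C -> D)
    (g : functor G) (f : functor F) (X : C) :
  fmap g (fmap f (idm X)) = idm (G (F X)).
Proof. by rewrite !fmap_id. Qed.

Lemma functor_comp_comp (C D E : category) (G : D -> E) (F : C -> D)
    (g : functor G) (f : functor F) (X Y Z : C) (h : arr Y Z) (k : arr X Y) :
  fmap g (fmap f (ccomp h k)) = ccomp (fmap g (fmap f h)) (fmap g (fmap f k)).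
Proof. by rewrite !fmap_comp. Qed.

Definition functor_comp (C D E : category) (G : D -> E) (F : C -> D)
    (g : functor G) (f : functor F) : functor (fun X => G (F X)) :=
  Functor (functor_comp_id g f) (@functor_comp_comp C D E G F g f).

Definition is_iso (C : category) (X Y : C) (f : arr X Y) : Prop :=
  exists g : arr Y X, ccomp g f = idm X /\ ccomp f g = idm Y.

Definition natural (C D : category) (F G : C -> D)
    (f : functor F) (g : functor G) (eta : forall X, arr (F X) (G X)) : Prop :=
  forall (X Y : C) (h : arr X Y),
    ccomp (fmap g h) (eta X) = ccomp (eta Y) (fmap f h).

(* The operations on quotients below are computed on representatives picked by
   [qrepr]; they do not depend on this choice when the relation is a congruence. *)
Definition quot (T : Type) (r : T -> T -> Prop) : Type :=
  {C : set T | exists x, C = r x}.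

Definition qclass (T : Type) (r : T -> T -> Prop) (x : T) : quot r :=
  exist _ (r x) (ex_intro _ x erefl).

Definition qrepr (T : Type) (r : T -> T -> Prop) (C : quot r) : T :=
  projT1 (cid (proj2_sig C)).

Record pmv_sig := PmvSig {
  pmv_car :> Type;
  oplus : pmv_car -> pmv_car -> pmv_car;
  mneg : pmv_car -> pmv_car;
  mzero : pmv_car;
  mprod : pmv_car -> pmv_car -> pmv_car }.

Arguments oplus {p} _ _.
Arguments mneg {p} _.
Arguments mzero {p}.
Arguments mprod {p} _ _.

Definition mone (A : pmv_sig) : A := mneg mzero.
Arguments mone {A}.
Definition odot (A : pmv_sig) (x y : A) : A := mneg (oplus (mneg x) (mneg y)).
Definition ominus (A : pmv_sig) (x y : A) : A := mneg (oplus (mneg x) y).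
Definition mle (A : pmv_sig) (x y : A) : Prop := ominus x y = mzero.
(* The standard term for the infimum of the lattice order [mle]. *)
Definition mmeet (A : pmv_sig) (x y : A) : A := odot x (oplus (mneg x) y).

Record is_mv (A : pmv_sig) : Prop := IsMV {
  mv_addA : associative (@oplus A);
  mv_addC : commutative (@oplus A);
  mv_add0 : left_id mzero (@oplus A);
  mv_negK : involutive (@mneg A);
  mv_add1 : forall x : A, oplus x (mneg mzero) = mneg mzero;
  mv_luk : forall x y : A,
    oplus (mneg (oplus (mneg x) y)) y = oplus (mneg (oplus (mneg y) x)) x }.

Record is_pmvf (A : pmv_sig) : Prop := IsPMVf {
  pmvf_mv : is_mv A;
  pmvf_mulA : associative (@mprod A);
  pmvf_mulC : commutative (@mprod A);
  pmvf_mul0 : forall a : A, mprod a mzero = mzero;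
  pmvf_mulD : forall a b c : A,
    mle (mprod a (oplus b c)) (oplus (mprod a b) (mprod a c));
  pmvf_mul_le : forall a b : A, mle (mprod a b) (mmeet a b);
  pmvf_mulB : forall a b c : A,
    mprod a (ominus b c) = ominus (mprod a b) (mprod a c) }.

Record pmvf := PMVfAlg { pmvf_sig :> pmv_sig; pmvfP : is_pmvf pmvf_sig }.

Record pmv_hom (A B : pmv_sig) := PmvHom {
  pmv_fun :> A -> B;
  pmv_homD : forall x y, pmv_fun (oplus x y) = oplus (pmv_fun x) (pmv_fun y);
  pmv_homN : forall x, pmv_fun (mneg x) = mneg (pmv_fun x);
  pmv_hom0 : pmv_fun mzero = mzero;
  pmv_homM : forall x y, pmv_fun (mprod x y) = mprod (pmv_fun x) (pmv_fun y) }.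

Lemma pmv_hom_ext (A B : pmv_sig) (f g : pmv_hom A B) : f =1 g -> f = g.
Proof.
case: f g => [f f1 f2 f3 f4] [g g1 g2 g3 g4] /= /funext fg.
by subst g; congr PmvHom; exact: Prop_irrelevance.
Qed.

Definition pmv_idm (A : pmv_sig) : pmv_hom A A :=
  @PmvHom A A id (fun _ _ => erefl) (fun _ => erefl) erefl (fun _ _ => erefl).

Definition pmv_comp (A B C : pmv_sig) (f : pmv_hom B C) (g : pmv_hom A B) :
  pmv_hom A C.
Proof.
exists (fun x => f (g x)).
- by move=> x y; rewrite !pmv_homD.
- by move=> x; rewrite !pmv_homN.
- by rewrite !pmv_hom0.
- by move=> x y; rewrite !pmv_homM.
Defined.

Definition PMVf : category.
Proof.
refine (@Category pmvf (fun A B => pmv_hom A B) (fun A => pmv_idm A)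
          (fun A B C f g => pmv_comp f g) _ _ _).
- by move=> A B f; apply: pmv_hom_ext.
- by move=> A B f; apply: pmv_hom_ext.
- by move=> A B C D f g h; apply: pmv_hom_ext.
Defined.

Record lu_sig := LuSig {
  lu_car :> Type;
  ladd : lu_car -> lu_car -> lu_car;
  lzero : lu_car;
  lopp : lu_car -> lu_car;
  lmul : lu_car -> lu_car -> lu_car;
  lle : lu_car -> lu_car -> Prop;
  lmeet : lu_car -> lu_car -> lu_car;
  ljoin : lu_car -> lu_car -> lu_car;
  lunit : lu_car }.

Arguments ladd {l} _ _.
Arguments lzero {l}.
Arguments lopp {l} _.
Arguments lmul {l} _ _.
Arguments lle {l} _ _.
Arguments lmeet {l} _ _.
Arguments ljoin {l} _ _.
Arguments lunit {l}.

Record is_lring (R : lu_sig) : Prop := IsLring {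
  l_addA : associative (@ladd R);
  l_addC : commutative (@ladd R);
  l_add0 : left_id lzero (@ladd R);
  l_addN : left_inverse lzero lopp (@ladd R);
  l_mulA : associative (@lmul R);
  l_mulC : commutative (@lmul R);
  l_mulD : left_distributive (@lmul R) (@ladd R);
  l_lexx : forall x : R, lle x x;
  l_le_anti : forall x y : R, lle x y -> lle y x -> x = y;
  l_le_trans : forall x y z : R, lle x y -> lle y z -> lle x z;
  l_le_meet : forall x y z : R, lle z (lmeet x y) <-> lle z x /\ lle z y;
  l_join_le : forall x y z : R, lle (ljoin x y) z <-> lle x z /\ lle y z;
  l_le_add : forall x y z : R, lle x y -> lle (ladd x z) (ladd y z);
  l_mul_ge0 : forall x y : R,
    lle lzero x -> lle lzero y -> lle lzero (lmul x y) }.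

Definition labs (R : lu_sig) (x : R) : R := ljoin x (lopp x).

Definition lunit_interval (R : lu_sig) : set R :=
  fun x => lle lzero x /\ lle x lunit.

Record is_lru (R : lu_sig) : Prop := IsLRu {
  lru_lring : is_lring R;
  lru_unit_ge0 : lle lzero (@lunit R);
  lru_strong : forall x : R,
    exists n : nat, lle (labs x) (iter n (ladd lunit) lzero);
  lru_semilow : forall a b : R, lunit_interval a -> lunit_interval b ->
    lle (lmul a b) (lmeet a b) }.

Record lru := LRuRing { lru_sig :> lu_sig; lruP : is_lru lru_sig }.

Record lu_hom (R S : lu_sig) := LuHom {
  lu_fun :> R -> S;
  lu_homD : forall x y, lu_fun (ladd x y) = ladd (lu_fun x) (lu_fun y);
  lu_homM : forall x y, lu_fun (lmul x y) = lmul (lu_fun x) (lu_fun y);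
  lu_hom_meet : forall x y, lu_fun (lmeet x y) = lmeet (lu_fun x) (lu_fun y);
  lu_hom_join : forall x y, lu_fun (ljoin x y) = ljoin (lu_fun x) (lu_fun y);
  lu_hom_unit : lu_fun lunit = lunit }.

Lemma lu_hom_ext (R S : lu_sig) (f g : lu_hom R S) : f =1 g -> f = g.
Proof.
case: f g => [f f1 f2 f3 f4 f5] [g g1 g2 g3 g4 g5] /= /funext fg.
by subst g; congr LuHom; exact: Prop_irrelevance.
Qed.

Definition lu_idm (R : lu_sig) : lu_hom R R :=
  @LuHom R R id (fun _ _ => erefl) (fun _ _ => erefl) (fun _ _ => erefl)
    (fun _ _ => erefl) erefl.

Definition lu_comp (R S T : lu_sig) (f : lu_hom S T) (g : lu_hom R S) :
  lu_hom R T.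
Proof.
exists (fun x => f (g x)).
- by move=> x y; rewrite !lu_homD.
- by move=> x y; rewrite !lu_homM.
- by move=> x y; rewrite !lu_hom_meet.
- by move=> x y; rewrite !lu_hom_join.
- by rewrite !lu_hom_unit.
Defined.

Definition LRu : category.
Proof.
refine (@Category lru (fun R S => lu_hom R S) (fun R => lu_idm R)
          (fun R S T f g => lu_comp f g) _ _ _).
- by move=> R S f; apply: lu_hom_ext.
- by move=> R S f; apply: lu_hom_ext.
- by move=> R S T U f g h; apply: lu_hom_ext.
Defined.

Lemma Gamma_oplus_subproof (R : lru) (x y : {x : R | lunit_interval x}) :
  lunit_interval (lmeet (ladd (sval x) (sval y)) lunit).
Proof.
case: x y => [x [x0 _]] [y [y0 _]] /=.
have L := lru_lring (lruP R); have u0 := lru_unit_ge0 (lruP R).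
split.
  apply/(l_le_meet L); split=> //.
  apply: (l_le_trans L) y0 _.
  by have := l_le_add L y x0; rewrite (l_add0 L).
by have [] := (l_le_meet L _ _ _).1 (l_lexx L (lmeet (ladd x y) lunit)).
Qed.

Lemma Gamma_neg_subproof (R : lru) (x : {x : R | lunit_interval x}) :
  lunit_interval (ladd lunit (lopp (sval x))).
Proof.
case: x => [x [x0 xu]] /=.
have L := lru_lring (lruP R).
have xN : ladd x (lopp x) = lzero by rewrite (l_addC L) (l_addN L).
split; first by have := l_le_add L (lopp x) xu; rewrite xN.
have := l_le_add L (ladd lunit (lopp x)) x0.
by rewrite (l_add0 L) (l_addC L lunit) (l_addA L) xN (l_add0 L).
Qed.

Lemma Gamma_zero_subproof (R : lru) : lunit_interval (@lzero R).
Proof.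
by split; [exact: l_lexx (lru_lring (lruP R)) _ | exact: lru_unit_ge0 (lruP R)].
Qed.

Lemma Gamma_prod_subproof (R : lru) (x y : {x : R | lunit_interval x}) :
  lunit_interval (lmul (sval x) (sval y)).
Proof.
case: x y => [x Ix] [y Iy] /=.
have L := lru_lring (lruP R).
split; first by apply: (l_mul_ge0 L); [case: Ix | case: Iy].
apply: (l_le_trans L) (lru_semilow (lruP R) Ix Iy) _.
have [lx _] := (l_le_meet L _ _ _).1 (l_lexx L (lmeet x y)).
by apply: (l_le_trans L) lx _; case: Ix.
Qed.

Definition Gamma_sig (R : lru) : pmv_sig :=
  @PmvSig {x : R | lunit_interval x}
    (fun x y => exist _ _ (Gamma_oplus_subproof x y))
    (fun x => exist _ _ (Gamma_neg_subproof x))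
    (exist _ _ (Gamma_zero_subproof R))
    (fun x y => exist _ _ (Gamma_prod_subproof x y)).

Record is_ideal (A : pmv_sig) (I : set A) : Prop := IsIdeal {
  ideal_neq0 : exists x, I x;
  ideal_down : forall x y, mle x y -> I y -> I x;
  ideal_oplus : forall x y, I x -> I y -> I (oplus x y) }.

(* The improper ideal is prime in this sense: it contributes a trivial factor
   to the product defining [sharp]. *)
Record is_prime (A : pmv_sig) (P : set A) : Prop := IsPrime {
  prime_ideal : is_ideal P;
  prime_meet : forall a b, P (mmeet a b) -> P a \/ P b }.

Definition Spec (A : pmv_sig) : Type := {P : set A | is_prime P}.

Definition ideal_equiv (A : pmv_sig) (I : set A) (x y : A) : Prop :=
  I (oplus (ominus x y) (ominus y x)).

Definition pmv_quot (A : pmv_sig) (I : set A) : pmv_sig :=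
  @PmvSig (quot (ideal_equiv I))
    (fun x y => qclass _ (oplus (qrepr x) (qrepr y)))
    (fun x => qclass _ (mneg (qrepr x)))
    (qclass _ mzero)
    (fun x y => qclass _ (mprod (qrepr x) (qrepr y))).

Definition pre_sharp (A : pmv_sig) : Type := (int * A)%type.

Inductive chain_step (A : pmv_sig) : pre_sharp A -> pre_sharp A -> Prop :=
  ChainStep (m : int) : chain_step ((m + 1)%R, mzero) (m, mone).

Definition chain_car (A : pmv_sig) : Type :=
  quot (Relation_Operators.clos_refl_sym_trans _ (@chain_step A)).

Definition chain_pair (A : pmv_sig) (m : int) (a : A) : chain_car A :=
  qclass _ ((m, a) : pre_sharp A).

Definition chain_add (A : pmv_sig) (x y : chain_car A) : chain_car A :=
  let: (m, a) := qrepr x in let: (n, b) := qrepr y in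
  if `[< oplus a b = mone >] then chain_pair (m + n + 1)%R (odot a b)
  else chain_pair (m + n)%R (oplus a b).

Definition chain_zero (A : pmv_sig) : chain_car A := chain_pair 0%R mzero.

Definition chain_opp (A : pmv_sig) (x : chain_car A) : chain_car A :=
  let: (m, a) := qrepr x in chain_pair (- m - 1)%R (mneg a).

Definition chain_zmul (A : pmv_sig) (k : int) (x : chain_car A) : chain_car A :=
  match k with
  | Posz n => iter n (chain_add x) (chain_zero A)
  | Negz n => chain_opp (iter n.+1 (chain_add x) (chain_zero A))
  end.

Definition chain_mul (A : pmv_sig) (x y : chain_car A) : chain_car A :=
  let: (m, a) := qrepr x in let: (n, b) := qrepr y in
  chain_add
    (chain_add
      (chain_add
        (chain_zmul (m * n)%R (chain_pair 0%R (mprod mone mone)))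
        (chain_zmul m (chain_pair 0%R (mprod b mone))))
      (chain_zmul n (chain_pair 0%R (mprod a mone))))
    (chain_pair 0%R (mprod a b)).

(* Representatives with second entry different from u exist and are unique
   unless A is trivial; for A trivial the carrier is a single point and the
   condition below is vacuous, so that the order is reflexive there too. *)
Definition chain_le (A : pmv_sig) (x y : chain_car A) : Prop :=
  forall (m n : int) (a b : A), x = chain_pair m a -> y = chain_pair n b ->
    a <> mone -> b <> mone -> (m < n)%R \/ (m = n /\ mle a b).

(* Meaningful when A is a PMV_f-chain, in which case [chain_le] is total. *)
Definition chain_sharp (A : pmv_sig) : lu_sig :=
  @LuSig (chain_car A) (@chain_add A) (chain_zero A) (@chain_opp A)
    (@chain_mul A) (@chain_le A)
    (fun x y => if `[< chain_le x y >] then x else y)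
    (fun x y => if `[< chain_le x y >] then y else x)
    (chain_pair 0%R mone).

Definition lu_prod (I : Type) (R : I -> lu_sig) : lu_sig :=
  @LuSig (forall i, R i)
    (fun f g i => ladd (f i) (g i)) (fun i => lzero) (fun f i => lopp (f i))
    (fun f g i => lmul (f i) (g i)) (fun f g => forall i, lle (f i) (g i))
    (fun f g i => lmeet (f i) (g i)) (fun f g i => ljoin (f i) (g i))
    (fun i => lunit).

Inductive lring_gen (R : lu_sig) (S : set R) : R -> Prop :=
| gen_base x : S x -> lring_gen S x
| gen_zero : lring_gen S lzero
| gen_add x y : lring_gen S x -> lring_gen S y -> lring_gen S (ladd x y)
| gen_opp x : lring_gen S x -> lring_gen S (lopp x)
| gen_mul x y : lring_gen S x -> lring_gen S y -> lring_gen S (lmul x y)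
| gen_meet x y : lring_gen S x -> lring_gen S y -> lring_gen S (lmeet x y)
| gen_join x y : lring_gen S x -> lring_gen S y -> lring_gen S (ljoin x y).

Definition lu_gen (R : lu_sig) (S : set R) (u : {x : R | lring_gen S x}) :
    lu_sig :=
  @LuSig {x : R | lring_gen S x}
    (fun x y => exist _ _ (gen_add (proj2_sig x) (proj2_sig y)))
    (exist _ _ (gen_zero S))
    (fun x => exist _ _ (gen_opp (proj2_sig x)))
    (fun x y => exist _ _ (gen_mul (proj2_sig x) (proj2_sig y)))
    (fun x y => lle (sval x) (sval y))
    (fun x y => exist _ _ (gen_meet (proj2_sig x) (proj2_sig y)))
    (fun x y => exist _ _ (gen_join (proj2_sig x) (proj2_sig y)))
    u.

Definition sharp_prod (A : pmv_sig) : lu_sig :=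
  lu_prod (fun P : Spec A => chain_sharp (pmv_quot (sval P))).

Definition hat (A : pmv_sig) (a : A) : sharp_prod A :=
  fun P => chain_pair 0%R (qclass (ideal_equiv (sval P)) a : pmv_quot (sval P)).

Definition hat_gen (A : pmv_sig) (a : A) :
    {x : sharp_prod A | lring_gen (range (@hat A)) x} :=
  exist _ (hat a) (gen_base (ex_intro2 _ _ a I erefl)).

Definition sharp_sig (A : pmv_sig) : lu_sig := lu_gen (hat_gen (@mone A)).

Definition sharp_hat (A : pmv_sig) (a : A) : sharp_sig A := hat_gen a.

(* As in [(-1) ^+ b], the boolean [true] encodes the sign -1. *)
Definition signed_sum (T : Type) (R : lu_sig) (f : T -> R)
    (s : seq (bool * T)) : R :=
  \big[ladd/lzero]_(p <- s) (if p.1 then lopp (f p.2) else f p.2).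

(* Main.v *)
Require Import Defs.
From HB Require Import structures.
From mathcomp Require Import all_boot all_order all_algebra.
From mathcomp Require Import boolp classical_sets.
From Stdlib Require Relations.Relation_Operators.

Set Implicit Arguments.
Unset Strict Implicit.
Unset Printing Implicit Defensive.

(** Everything rests on a universal property of the ring of an algebra [A]:
    a homomorphism [f] from [A] to the unit interval of a semi-low ring [R]
    extends uniquely to a homomorphism from the ring of [A] to [R]
    ([sharp_extension], [sharp_hom_ext]). Applied to the composite of a
    homomorphism from [A] to [B] with the embedding of [B] it gives the action
    of the functor on morphisms; applied to the identity of the unit interval of
    [R] it gives [tau]. The naturality of the embedding says that these extensions
    do extend. Uniqueness yields the functor laws and the naturality of [tau],
    since two homomorphisms out of the ring of [A] need only be compared on the
    elements [sharp_hat a].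

    The extension and the bijectivity of both maps come from unary expansions.
    In any lattice-ordered group with a distinguished [u >= 0], a bounded element
    is determined by the truncations of its translates to the interval from 0 to
    [u], its digits, for it is their sum up to a multiple of [u]
    ([unary_expansion]). Digits commute with meets and joins, and adding an
    element [a] of the interval changes them by a carry rule which involves
    only the operations of the interval ([clip_carry]). Hence if a map [f]
    from [A] into a ring [S] turns the operations of [A] into those of the unit
    interval, then the bounded elements with all digits in the image of [f] are
    exactly the sums of values of [f] and their opposites, and form the
    lattice-ordered subring generated by that image ([digital_gspan],
    [gspan_digital], [lring_gen_gspan]). For the embedding of [A] in the product of the rings of
    its prime quotients this says that the ring of [A] is additively generated by
    [A], has a strong unit and has unit interval [A]. For the map from [A] into
    the product of that ring with [R], given by the embedding and [f], it shows
    that the subring generated by the pairs so obtained is the graph of a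
    function, the extension of [f]. Finally [tau] is injective because it
    preserves digits and every digit is some [sharp_hat a].

    Two facts about the construction itself are needed. The first is that the
    ring of a chain is one: addition is addition of digits with a carry, whose
    associativity is a symmetry of the carry of three summands ([carry3_swap]);
    the product of the chain is additive wherever the sum does not overflow and
    so extends biadditively ([chain_ext_additive]). The second is that primes
    separate points ([prime_separates]), by Zorn's lemma; it makes the embedding
    injective. *)

(** * Arithmetic of MV-algebras *)

Declare Scope mv_scope.
Delimit Scope mv_scope with mv.
Local Notation "x (+) y" := (oplus x y) : mv_scope.
Local Notation "x (-) y" := (ominus x y)
  (at level 50, left associativity) : mv_scope.
Local Notation "x (&) y" := (odot x y)
  (at level 40, left associativity) : mv_scope.
Local Notation "x <=m y" := (mle x y) (at level 70, no associativity) : mv_scope.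
Local Notation "x ^m" := (mneg x) (at level 2, format "x ^m") : mv_scope.
Local Open Scope mv_scope.

Section MVTheory.
Variables (A : pmv_sig) (HA : is_mv A).
Implicit Types x y z a b c : A.

Lemma mv_plusA x y z : x (+) (y (+) z) = x (+) y (+) z.
Proof. exact: mv_addA. Qed.

Lemma mv_plusC x y : x (+) y = y (+) x.
Proof. exact: mv_addC. Qed.

Lemma mv_0plus x : mzero (+) x = x.
Proof. exact: mv_add0. Qed.

Lemma mv_plus0 x : x (+) mzero = x.
Proof. by rewrite mv_plusC mv_0plus. Qed.

Lemma mv_plus1 x : x (+) mone = mone.
Proof. exact: mv_add1. Qed.

Lemma mv_1plus x : mone (+) x = mone.
Proof. by rewrite mv_plusC mv_plus1. Qed.

Lemma mv_nK x : x^m^m = x.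
Proof. exact: mv_negK. Qed.

Lemma mv_n_inj : injective (@mneg A).
Proof. exact: can_inj mv_nK. Qed.

Lemma mv_n0 : mzero^m = mone :> A.
Proof. by []. Qed.

Lemma mv_n1 : mone^m = mzero :> A.
Proof. exact: mv_nK. Qed.

Lemma mv_plusAC x y z : x (+) y (+) z = x (+) z (+) y.
Proof. by rewrite -!mv_plusA (mv_plusC y). Qed.

Lemma mv_plusACA x y z t : x (+) y (+) (z (+) t) = x (+) z (+) (y (+) t).
Proof. by rewrite !mv_plusA (mv_plusAC x y z). Qed.

Lemma mv_nplus x : x^m (+) x = mone.
Proof.
by have := mv_luk HA x mone; rewrite !mv_plus1 mv_n1 mv_0plus => ->.
Qed.

Lemma mleE x y : x <=m y <-> x^m (+) y = mone.
Proof.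
rewrite /mle /ominus; split => [/(congr1 (@mneg A))|->]; last exact: mv_n1.
by rewrite mv_nK.
Qed.

Lemma ominusK x y : (x (-) y) (+) y = (y (-) x) (+) x.
Proof. exact: (mv_luk HA). Qed.

Lemma mle_plus x y : x <=m x (+) y.
Proof. by apply/mleE; rewrite mv_plusA mv_nplus mv_1plus. Qed.

Lemma mle_plusl x y : x <=m y (+) x.
Proof. by rewrite mv_plusC; apply: mle_plus. Qed.

Lemma mle_ominusK x y : x <=m (x (-) y) (+) y.
Proof. by rewrite ominusK; apply: mle_plusl. Qed.

Lemma mle_oplusE x y : x <=m y -> y = (y (-) x) (+) x.
Proof. by rewrite -ominusK => ->; rewrite mv_0plus. Qed.

Lemma mle_refl x : x <=m x.
Proof. by apply/mleE/mv_nplus. Qed.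

Lemma mle_anti x y : x <=m y -> y <=m x -> x = y.
Proof. by move=> xy /mle_oplusE; rewrite xy mv_0plus. Qed.

Lemma mle_trans y x z : x <=m y -> y <=m z -> x <=m z.
Proof.
by move=> /mle_oplusE-> /mle_oplusE->; rewrite mv_plusA; apply: mle_plusl.
Qed.

Lemma mle0 x : mzero <=m x.
Proof. by rewrite -(mv_0plus x); apply: mle_plus. Qed.

Lemma mle1 x : x <=m mone.
Proof. by apply/mleE/mv_plus1. Qed.

Lemma mle_eq0 x : x <=m mzero -> x = mzero.
Proof. by move=> /mle_anti; apply; apply: mle0. Qed.

Lemma mle_eq1 x : mone <=m x -> x = mone.
Proof. by move=> h; apply: mle_anti h; apply: mle1. Qed.

Lemma mle_neg x y : x <=m y -> y^m <=m x^m.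
Proof. by move=> /mleE h; apply/mleE; rewrite mv_nK mv_plusC. Qed.

Lemma mle_negl x y : x^m <=m y <-> y^m <=m x.
Proof. by split=> /mle_neg; rewrite mv_nK. Qed.

Lemma mle_negr x y : x <=m y^m <-> y <=m x^m.
Proof. by split=> /mle_neg; rewrite mv_nK. Qed.

(** Residuation: both sides say that [x^m (+) y (+) z] is the unit. *)
Lemma ominus_le x y z : x (-) y <=m z <-> x <=m y (+) z.
Proof. by rewrite !mleE /ominus mv_nK mv_plusA. Qed.

Lemma mle_plus2 x y a b : x <=m y -> a <=m b -> x (+) a <=m y (+) b.
Proof.
by move=> /mle_oplusE-> /mle_oplusE->; rewrite mv_plusACA; apply: mle_plusl.
Qed.

Lemma ominus_self x : x (-) x = mzero.
Proof. exact: mle_refl. Qed.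

Lemma ominus_neg x y : x^m (-) y^m = y (-) x.
Proof. by rewrite /ominus mv_nK mv_plusC. Qed.

Lemma odotE x y : x (&) y = x (-) y^m.
Proof. by []. Qed.

Lemma odot_ominus x y : x (-) y = x (&) y^m.
Proof. by rewrite /odot mv_nK. Qed.

Lemma odotC x y : x (&) y = y (&) x.
Proof. by rewrite /odot mv_plusC. Qed.

Lemma odotA x y z : x (&) (y (&) z) = x (&) y (&) z.
Proof. by rewrite /odot !mv_nK mv_plusA. Qed.

Lemma odot1 x : x (&) mone = x.
Proof. by rewrite /odot mv_n1 mv_plus0 mv_nK. Qed.

Lemma odot0 x : x (&) mzero = mzero.
Proof. by rewrite /odot mv_n0 mv_plus1 mv_n1. Qed.

Lemma neg_odot x y : (x (&) y)^m = x^m (+) y^m.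
Proof. exact: mv_nK. Qed.

Lemma neg_oplus x y : (x (+) y)^m = x^m (&) y^m.
Proof. by rewrite /odot !mv_nK. Qed.

Lemma oplus_eq1 x y : x (+) y = mone <-> x^m <=m y.
Proof. by rewrite mleE mv_nK. Qed.

Lemma odot_le x y : x (&) y <=m x.
Proof. by rewrite odotE; apply/ominus_le/mle_plusl. Qed.

Lemma odot_eq1 x y : x (&) y = mone -> x = mone.
Proof. by move=> e; apply: mle_eq1; rewrite -e; apply: odot_le. Qed.

(** By [ominusK] the expression [x - y + y] is symmetric in [x] and [y], which
    makes it an upper bound of both; here it is the least one. *)
Lemma mv_join_le x y z : x <=m z -> y <=m z -> (x (-) y) (+) y <=m z.
Proof.
move=> xz yz; rewrite (mle_oplusE yz).
apply: mle_plus2; last exact: mle_refl.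
by apply/ominus_le; rewrite mv_plusC -mle_oplusE.
Qed.

Lemma mmeetE x y : mmeet x y = ((y^m (-) x^m) (+) x^m)^m.
Proof. by rewrite /mmeet /odot mv_plusC /ominus mv_nK (mv_plusC y). Qed.

Lemma mmeetC x y : mmeet x y = mmeet y x.
Proof. by rewrite !mmeetE ominusK. Qed.

Lemma mmeet_lel x y : mmeet x y <=m x.
Proof. exact: odot_le. Qed.

Lemma mmeet_ler x y : mmeet x y <=m y.
Proof. by rewrite mmeetC; apply: mmeet_lel. Qed.

Lemma mle_meet x y z : z <=m x -> z <=m y -> z <=m mmeet x y.
Proof. by move=> zx zy; rewrite mmeetE; apply/mle_negr/mv_join_le; exact: mle_neg. Qed.

Lemma oplusK x y : (x (+) y) (-) y = mmeet x y^m.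
Proof.
by rewrite mmeetC /mmeet mv_nK odotC (mv_plusC y) -odot_ominus.
Qed.

Lemma oplusK_le x y : x <=m y^m -> (x (+) y) (-) y = x.
Proof.
move=> h; rewrite oplusK; apply: mle_anti; first exact: mmeet_lel.
by apply: mle_meet h; exact: mle_refl.
Qed.

Lemma oplus_meetl x y z : mmeet x y (+) z = mmeet (x (+) z) (y (+) z).
Proof.
apply: mle_anti.
  by apply: mle_meet; apply: mle_plus2 (mle_refl z);
    [exact: mmeet_lel | exact: mmeet_ler].
rewrite [X in _ <=m X]mv_plusC; apply/(ominus_le _ z (mmeet x y)).
apply: mle_meet; apply/ominus_le; rewrite [X in _ <=m X]mv_plusC.
  exact: mmeet_lel.
exact: mmeet_ler.
Qed.

Lemma mmeet_plus_ominus x y : mmeet x y (+) (x (-) y) = x.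
Proof.
rewrite [mmeet x y](_ : _ = x (-) (x (-) y)) //.
by rewrite -mle_oplusE // odot_ominus; apply: odot_le.
Qed.

(** With [t] the meet of [x] and [y], adding [t] to [x - y] and [y - x] yields
    [x] and [y]; hence the meet [w] of these differences has [w + t = t], and
    cancelling [t], which is possible below its complement, gives [w = 0]. *)
Lemma mv_prelinear x y : mmeet (x (-) y) (y (-) x) = mzero.
Proof.
set w := mmeet _ _; set t := mmeet x y.
have wt : w (+) t = t.
  rewrite oplus_meetl /t ![_ (+) mmeet x y]mv_plusC mmeet_plus_ominus.
  by rewrite [mmeet x y in X in mmeet _ X]mmeetC mmeet_plus_ominus.
have w_le : w <=m t^m.
  apply: mle_trans (mmeet_lel _ _) _; rewrite odot_ominus odotC.
  apply: mle_trans (odot_le _ _) _.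
  exact/mle_neg/mmeet_ler.
by rewrite -(oplusK_le w_le) wt ominus_self.
Qed.

(** It follows that the elements disjoint from [x] are closed under sums. *)
Lemma mmeet_oplus_le x y z : mmeet x (y (+) z) <=m mmeet x y (+) mmeet x z.
Proof.
rewrite oplus_meetl ![_ (+) mmeet x z]mv_plusC !oplus_meetl.
apply: mle_meet; apply: mle_meet.
- by apply: mle_trans (mmeet_lel _ _) _; apply: mle_plus.
- by apply: mle_trans (mmeet_lel _ _) _; apply: mle_plusl.
- by apply: mle_trans (mmeet_lel _ _) _; apply: mle_plus.
by rewrite [z (+) y]mv_plusC; apply: mmeet_ler.
Qed.

(** The difference satisfies a triangle inequality, so that being zero modulo an
    ideal is transitive. *)
Lemma ominus_tri y x z : x (-) z <=m (x (-) y) (+) (y (-) z).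
Proof.
apply/ominus_le; rewrite mv_plusC -mv_plusA.
apply: mle_trans (mle_ominusK x y) _.
exact: mle_plus2 (mle_refl _) (mle_ominusK y z).
Qed.

Lemma ominus_plus_le x y z : (x (+) z) (-) (y (+) z) <=m x (-) y.
Proof.
apply/ominus_le; rewrite mv_plusAC [y (+) _]mv_plusC.
exact: mle_plus2 (mle_ominusK x y) (mle_refl z).
Qed.

Lemma oplus_eq0 x y : x (+) y = mzero -> x = mzero.
Proof. by move=> e; apply: mle_eq0; rewrite -e; apply: mle_plus. Qed.

End MVTheory.

(** * Quotients by prime ideals *)

Section Quot.
Variables (T : Type) (r : T -> T -> Prop).
Hypotheses (r_refl : forall x, r x x) (r_sym : forall x y, r x y -> r y x)
  (r_trans : forall x y z, r x y -> r y z -> r x z).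

Lemma qclass_eq x y : qclass r x = qclass r y <-> r x y.
Proof.
split=> [/(congr1 sval) /= e|rxy]; first by rewrite e.
have e : r x = r y.
  apply/funext => z; apply/propext; split; first exact/r_trans/r_sym.
  exact: r_trans.
by rewrite /qclass; apply: eq_exist.
Qed.

Lemma qreprK (C : quot r) : qclass r (qrepr C) = C.
Proof.
case: C => C HC; apply: eq_exist.
by rewrite /qrepr; case: cid.
Qed.

Lemma qrepr_class x : r x (qrepr (qclass r x)).
Proof. by apply/qclass_eq; rewrite qreprK. Qed.

End Quot.

Section Quotient.
Variables (A : pmv_sig) (HA : is_pmvf A) (J : set A) (HJ : is_ideal J).
Implicit Types x y z a b c : A.

Let MV : is_mv A := pmvf_mv HA.

Lemma mprod_ler a b : mprod a b <=m b.
Proof. exact: mle_trans (pmvf_mul_le HA a b) (mmeet_ler MV a b). Qed.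

Lemma mprod_lel a b : mprod a b <=m a.
Proof. exact: mle_trans (pmvf_mul_le HA a b) (mmeet_lel MV a b). Qed.

Lemma ideal0 : J mzero.
Proof. by have [x] := ideal_neq0 HJ; apply: (ideal_down HJ); apply: mle0. Qed.

(** The order of the quotient, read on representatives; the congruence is
    its symmetric part. *)
Definition ideal_le x y := J (x (-) y).

Lemma ideal_equivE x y : ideal_equiv J x y <-> ideal_le x y /\ ideal_le y x.
Proof.
split=> [Jxy|[]]; last exact: (ideal_oplus HJ).
by split; apply: (ideal_down HJ) Jxy; [exact: mle_plus | exact: mle_plusl].
Qed.

Lemma mle_ideal_le x y : x <=m y -> ideal_le x y.
Proof. by rewrite /ideal_le => ->; apply: ideal0. Qed.

Lemma ideal_le_trans x y z : ideal_le x y -> ideal_le y z -> ideal_le x z.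
Proof.
by move=> xy yz; apply: (ideal_down HJ) (ideal_oplus HJ xy yz); apply: ominus_tri.
Qed.

Lemma ideal_leD x y a b :
  ideal_le x y -> ideal_le a b -> ideal_le (x (+) a) (y (+) b).
Proof.
move=> xy ab; apply: (@ideal_le_trans _ (y (+) a)).
  by apply: (ideal_down HJ) xy; apply: ominus_plus_le.
apply: (ideal_down HJ) ab; rewrite !(mv_plusC MV y).
exact: ominus_plus_le.
Qed.

Lemma ideal_leN x y : ideal_le x y -> ideal_le y^m x^m.
Proof. by rewrite /ideal_le ominus_neg. Qed.

Lemma ideal_leM x y a b :
  ideal_le x y -> ideal_le a b -> ideal_le (mprod x a) (mprod y b).
Proof.
move=> xy ab; apply: (@ideal_le_trans _ (mprod y a)).
  rewrite !(pmvf_mulC HA _ a) /ideal_le -(pmvf_mulB HA).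
  by apply: (ideal_down HJ) xy; apply: mprod_ler.
rewrite /ideal_le -(pmvf_mulB HA).
by apply: (ideal_down HJ) ab; apply: mprod_ler.
Qed.

Lemma ideal_equiv_refl x : ideal_equiv J x x.
Proof. by apply/ideal_equivE; split; apply/mle_ideal_le/mle_refl. Qed.

Lemma ideal_equiv_sym x y : ideal_equiv J x y -> ideal_equiv J y x.
Proof. by move=> /ideal_equivE[? ?]; apply/ideal_equivE. Qed.

Lemma ideal_equiv_trans x y z :
  ideal_equiv J x y -> ideal_equiv J y z -> ideal_equiv J x z.
Proof.
move=> /ideal_equivE[xy yx] /ideal_equivE[yz zy].
by apply/ideal_equivE; split; [exact: ideal_le_trans yz | exact: ideal_le_trans yx].
Qed.

Definition pclass x : pmv_quot J := qclass (ideal_equiv J) x.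

Lemma pclass_eq x y : pclass x = pclass y <-> ideal_equiv J x y.
Proof.
exact: (qclass_eq ideal_equiv_refl ideal_equiv_sym ideal_equiv_trans).
Qed.

Lemma pclassP (X : pmv_quot J) : exists x, X = pclass x.
Proof. by exists (qrepr X); rewrite /pclass qreprK. Qed.

Let repr_le x :
  ideal_le (qrepr (pclass x)) x /\ ideal_le x (qrepr (pclass x)).
Proof. by apply/ideal_equivE/pclass_eq; rewrite /pclass qreprK. Qed.

Lemma pclassD x y : oplus (pclass x) (pclass y) = pclass (x (+) y).
Proof.
have [? ?] := repr_le x; have [? ?] := repr_le y.
by apply/pclass_eq/ideal_equivE; split; apply: ideal_leD.
Qed.

Lemma pclassN x : mneg (pclass x) = pclass (mneg x).
Proof.
have [? ?] := repr_le x.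
by apply/pclass_eq/ideal_equivE; split; apply: ideal_leN.
Qed.

Lemma pclassM x y : mprod (pclass x) (pclass y) = pclass (mprod x y).
Proof.
have [? ?] := repr_le x; have [? ?] := repr_le y.
by apply/pclass_eq/ideal_equivE; split; apply: ideal_leM.
Qed.

Lemma pclass0 : mzero = pclass mzero.
Proof. by []. Qed.

Lemma pclassB x y : ominus (pclass x) (pclass y) = pclass (x (-) y).
Proof. by rewrite /ominus !(pclassN, pclassD). Qed.

Lemma pmv_quotP : is_pmvf (pmv_quot J).
Proof.
split; first split.
- move=> X Y Z; have [[x ->] [y ->] [z ->]] := And3 (pclassP X) (pclassP Y) (pclassP Z).
  by rewrite !pclassD mv_plusA.
- move=> X Y; have [[x ->] [y ->]] := conj (pclassP X) (pclassP Y).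
  by rewrite !pclassD mv_plusC.
- by move=> X; have [x ->] := pclassP X; rewrite pclass0 pclassD mv_0plus.
- by move=> X; have [x ->] := pclassP X; rewrite !pclassN mv_nK.
- move=> X; have [x ->] := pclassP X; rewrite pclass0 pclassN pclassD.
  by rewrite (mv_add1 MV).
- move=> X Y; have [[x ->] [y ->]] := conj (pclassP X) (pclassP Y).
  by rewrite !(pclassN, pclassD) (mv_luk MV).
- move=> X Y Z; have [[x ->] [y ->] [z ->]] := And3 (pclassP X) (pclassP Y) (pclassP Z).
  by rewrite !pclassM (pmvf_mulA HA).
- move=> X Y; have [[x ->] [y ->]] := conj (pclassP X) (pclassP Y).
  by rewrite !pclassM (pmvf_mulC HA).
- by move=> X; have [x ->] := pclassP X; rewrite pclass0 pclassM (pmvf_mul0 HA).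
- move=> X Y Z; have [[x ->] [y ->] [z ->]] := And3 (pclassP X) (pclassP Y) (pclassP Z).
  rewrite !(pclassM, pclassD) /mle pclassB.
  by rewrite [in LHS](pmvf_mulD HA x y z).
- move=> X Y; have [[x ->] [y ->]] := conj (pclassP X) (pclassP Y).
  rewrite /mle /mmeet /odot !(pclassN, pclassD, pclassM) pclassB.
  by rewrite [in LHS](pmvf_mul_le HA x y).
move=> X Y Z; have [[x ->] [y ->] [z ->]] := And3 (pclassP X) (pclassP Y) (pclassP Z).
by rewrite !(pclassM, pclassB) (pmvf_mulB HA).
Qed.

End Quotient.

(** Primality applied to the disjoint elements [x - y] and [y - x]. *)
Lemma prime_quot_total (A : pmv_sig) (HA : is_pmvf A) (P : set A)
  (HP : is_prime P) (X Y : pmv_quot P) : mle X Y \/ mle Y X.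
Proof.
have HJ := prime_ideal HP; have MV := pmvf_mv HA.
have [x ->] := pclassP X; have [y ->] := pclassP Y.
have quot0 z : P z -> pclass P z = mzero.
  move=> Pz; apply/(pclass_eq HA HJ)/(ideal_equivE HA HJ); split; last first.
    exact/(mle_ideal_le HA HJ)/mle0.
  by apply: (ideal_down HJ) Pz; rewrite odot_ominus //; apply: odot_le.
have [|/quot0 h|/quot0 h] := @prime_meet _ _ HP (x (-) y) (y (-) x).
- by rewrite mv_prelinear //; apply: (ideal0 HA HJ).
- by left; rewrite /mle (pclassB HA HJ).
by right; rewrite /mle (pclassB HA HJ).
Qed.

Section Separation.
Variables (A : pmv_sig) (HA : is_mv A).
Implicit Types (x y z a b c : A) (P : set A).

(** The ideals missing [a], together with the empty set, which is the union of
    the empty chain in Zorn's lemma. *)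
Let avoids a P := [/\ forall x y, x <=m y -> P y -> P x,
  forall x y, P x -> P y -> P (x (+) y) & ~ P a].

Let mmul n b := iter n (oplus b) mzero.

(** The ideal generated by [P] and [b], when [P] is an ideal. *)
Let adjoin P b := fun x => exists p n, P p /\ x <=m p (+) mmul n b.

Let mmulD m n b : mmul (m + n) b = mmul m b (+) mmul n b.
Proof.
elim: m => [|m IH]; first by rewrite mv_0plus.
by rewrite addSn /= IH mv_plusA.
Qed.

Let mmul_disjoint n b c : mmeet c b = mzero -> mmeet c (mmul n b) = mzero.
Proof.
move=> cb; elim: n => [|n IH] /=; apply: (mle_eq0 HA).
  exact: mmeet_ler.
by apply: mle_trans (mmeet_oplus_le _ _ _ _) _ => //; rewrite cb IH mv_0plus //;
  apply: mle_refl.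
Qed.

(** A maximal ideal missing [a] is prime: if it contained neither of the
    disjoint elements [b = x - y] and [c = y - x], then [a] would lie below
    [p + mb] and [p + nc] for some [p] in it, thus below [p]. *)
Lemma prime_separates a : a <> mzero -> exists P, is_prime P /\ ~ P a.
Proof.
move=> a0.
have [F FP totF|P [[Pdown Pplus Pa] Pmax]] := @Zorn_bigcup A (avoids a).
  split.
  - by move=> x y xy [X FX Xy]; exists X => //; have [d _ _] := FP _ FX; apply: d Xy.
  - move=> x y [X FX Xx] [Y FY Yy].
    have [XY|YX] := totF _ _ FX FY.
      by exists Y => //; have [_ d _] := FP _ FY; apply: d => //; apply: XY.
    by exists X => //; have [_ d _] := FP _ FX; apply: d => //; apply: YX.
  by move=> [X FX Xa]; have [_ _] := FP _ FX; apply.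
have P0 : P mzero.
  apply: contrapT => NP0; refine (Pmax [set mzero]%classic _ _); [split|split].
  - by move=> x Px; case: NP0; apply: Pdown Px; apply: mle0.
  - by move=> sub; apply: NP0; apply: sub.
  - by move=> x y xy y0; rewrite /= y0 in xy; apply: mle_eq0 xy.
  - by move=> x y /= -> ->; rewrite mv_0plus.
  - by move=> /= /a0.
have adjoinP b : ~ P b -> adjoin P b a.
  move=> Pb; apply: contrapT => Qa; refine (Pmax (adjoin P b) _ _); [split|split].
  - by move=> x Px; exists x, 0%N; split=> //; apply: mle_plus.
  - move=> sub; apply: Pb; apply: sub; exists mzero, 1%N; split=> //.
    by rewrite /= mv_0plus // mv_plus0 //; apply: mle_refl.
  - by move=> x y xy [p [n [Pp h]]]; exists p, n; split=> //; apply: mle_trans h.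
  - move=> x y [p [m [Pp hp]]] [q [n [Pq hq]]].
    exists (p (+) q), (m + n)%N; split; first exact: Pplus.
    by rewrite mmulD mv_plusACA //; apply: mle_plus2.
  - exact: Qa.
(* In the quotient by a maximal [P] missing [a] any [x] and [y] compare. *)
have total x y : P (x (-) y) \/ P (y (-) x).
  apply: contrapT => /not_orP[/adjoinP[p [m [Pp hp]]] /adjoinP[q [n [Pq hq]]]].
  apply: Pa; apply: (Pdown _ (p (+) q)); last exact: Pplus.
  have disj : mmeet (mmul m (x (-) y)) (mmul n (y (-) x)) = mzero.
    apply: mmul_disjoint; rewrite mmeetC //; apply: mmul_disjoint.
    by rewrite mmeetC // mv_prelinear.
  rewrite -[p (+) q](mv_0plus HA) -disj oplus_meetl //.
  apply: mle_meet => //.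
    apply: mle_trans hp _; rewrite // mv_plusC //.
    by apply: mle_plus2 (mle_refl _ _) _ => //; apply: mle_plus.
  apply: mle_trans hq _; rewrite // mv_plusC //.
  by apply: mle_plus2 (mle_refl _ _) _ => //; apply: mle_plusl.
exists P; split=> //; split.
  by split; [exists mzero | exact: Pdown | exact: Pplus].
move=> x y Pxy; have [h|h] := total x y; [left | right].
  by rewrite -(mmeet_plus_ominus HA x y); apply: Pplus.
by rewrite -(mmeet_plus_ominus HA y x) mmeetC //; apply: Pplus.
Qed.

End Separation.

(** * The lattice-ordered ring of a chain *)

Record pmv_chain := PmvChain {
  chain_sig :> pmv_sig;
  chain_pmvf : is_pmvf chain_sig;
  chain_total : forall a b : chain_sig, mle a b \/ mle b a }.

Section Carry.
Variable C : pmv_chain.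
Implicit Types a b c : C.

Let MV : is_mv C := pmvf_mv (chain_pmvf C).

(** When [a + b + c] is written as a sum of three digits, the first is the
    truncated sum and the last is [a (&) b (&) c]; this is the middle one, made
    of the overflow of [a + b] and of that caused by adding [c]. *)
Definition carry3 a b c : C := ((a (+) b) (&) c) (+) (a (&) b).

(** The two sums with [b] do not overflow, so [a] and [c] can be recovered from
    them by subtracting [b]. *)
Let carry3_small a b c : a <=m b^m -> c <=m b^m ->
  (a (+) b) (&) c = (c (+) b) (&) a.
Proof.
move=> ab cb.
rewrite -{1}(oplusK_le MV cb) -{2}(oplusK_le MV ab) !(odot_ominus MV).
by rewrite !(odotA MV) (odotC MV (a (+) b)).
Qed.

Let carry3_mixed a b c : a^m <=m b -> c <=m b^m ->
  c (+) (a (&) b) = (c (+) b) (&) a.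
Proof.
move=> ab cb.
have eb : b = (a (&) b) (+) a^m.
  by rewrite {1}(mle_oplusE MV ab) (odotC MV) (odot_ominus MV) (mv_nK MV).
rewrite [RHS]odotE {2}eb (mv_plusA MV) (oplusK_le MV) //.
rewrite (mv_nK MV) (mv_plusC MV).
rewrite (mle_oplusE MV ((mle_negl MV _ _).1 ab)); apply: (mle_plus2 MV) cb.
rewrite (odot_ominus MV) (mv_nK MV) -(mle_oplusE MV ((mle_negl MV _ _).1 ab)).
exact: mle_refl.
Qed.

(** The case where both sums overflow is dual to [carry3_small]. *)
Lemma carry3_swap a b c : carry3 a b c = carry3 c b a.
Proof.
have sum1 x : x^m <=m b -> x (+) b = mone by move=> /oplus_eq1->.
have dot0 x : x <=m b^m -> x (&) b = mzero by [].
rewrite /carry3.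
have [ab|ba] := chain_total a^m b; have [cb|bc] := chain_total c^m b.
- rewrite !sum1 // !(odotC MV mone) !(odot1 MV); apply: (mv_n_inj MV).
  rewrite !(neg_oplus MV) !(neg_odot MV) !(odotC MV _ (_ (+) _)).
  by apply/esym/carry3_small; rewrite (mv_nK MV).
- have {}bc : c <=m b^m by apply/(mle_negr MV).
  by rewrite (sum1 a) // (dot0 c) // (odotC MV mone) (odot1 MV) (mv_plus0 MV)
    carry3_mixed.
- have {}ba : a <=m b^m by apply/(mle_negr MV).
  by rewrite (sum1 c) // (dot0 a) // (odotC MV mone) (odot1 MV) (mv_plus0 MV)
    (carry3_mixed cb).
have {}bc : c <=m b^m by apply/(mle_negr MV).
have {}ba : a <=m b^m by apply/(mle_negr MV).
by rewrite !dot0 // !(mv_plus0 MV) carry3_small.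
Qed.

Lemma carry3C a b c : carry3 a b c = carry3 b a c.
Proof. by rewrite /carry3 (mv_plusC MV a) (odotC MV a). Qed.

Lemma carry3_rot a b c : carry3 a b c = carry3 b c a.
Proof. by rewrite carry3C carry3_swap carry3C carry3_swap. Qed.

End Carry.

Section ChainGroup.
Variable C : pmv_chain.
Implicit Types (a b c : C) (m n k : int).

Let MV : is_mv C := pmvf_mv (chain_pmvf C).

Local Notation crel := (Relation_Operators.clos_refl_sym_trans _ (@chain_step C)).
Local Notation pair := (@chain_pair C).

Let crel_refl p : crel p p. Proof. exact: Relation_Operators.rst_refl. Qed.
Let crel_sym p q : crel p q -> crel q p.
Proof. exact: Relation_Operators.rst_sym. Qed.
Let crel_trans p q r : crel p q -> crel q r -> crel p r.
Proof. exact: Relation_Operators.rst_trans. Qed.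

(** The operations of a chain's ring are defined on chosen representatives; a
    function of the representative that respects the identification of
    [(m + 1, 0)] with [(m, u)] can be computed on any other one. *)
Lemma chain_pair_lift (T : Type) (h : pre_sharp C -> T) :
  (forall m, h ((m + 1)%R, mzero) = h (m, mone)) ->
  forall m a, h (qrepr (pair m a)) = h (m, a).
Proof.
move=> hP m a; apply/esym.
have := qrepr_class crel_refl crel_sym crel_trans (m, a).
rewrite -/(pair m a); elim=> [p q []|p|p q _ ->|p q r _ -> _ ->] //.
Qed.

Lemma chain_pair_eq m a n b (T : Type) (h : pre_sharp C -> T) :
  (forall m, h ((m + 1)%R, mzero) = h (m, mone)) ->
  pair m a = pair n b -> h (m, a) = h (n, b).
Proof. by move=> hP e; rewrite -(chain_pair_lift hP m) e chain_pair_lift. Qed.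

Lemma chain_pair_step m : pair (m + 1)%R mzero = pair m mone.
Proof.
apply/(qclass_eq crel_refl crel_sym crel_trans).
exact/Relation_Operators.rst_step/ChainStep.
Qed.

Lemma chain_carP (x : chain_car C) : exists m a, x = pair m a.
Proof.
by case ex: (qrepr x) => [m a]; exists m, a; rewrite /chain_pair -ex qreprK.
Qed.

Lemma chain_addE m a n b : chain_add (pair m a) (pair n b) =
  if `[< (a (+) b)%mv = mone >] then pair (m + n + 1)%R (a (&) b)
  else pair (m + n)%R (a (+) b).
Proof.
pose h (p q : pre_sharp C) :=
  if `[< (p.2 (+) q.2)%mv = mone >] then pair (p.1 + q.1 + 1)%R (p.2 (&) q.2)
  else pair (p.1 + q.1)%R (p.2 (+) q.2).
have hC p q : h p q = h q p.
  by rewrite /h (mv_plusC MV) (odotC MV) (GRing.addrC p.1).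
have hP q k : h ((k + 1)%R, mzero) q = h (k, mone) q.
  case: q => [l d]; rewrite /h /= (mv_0plus MV) (mv_1plus MV).
  rewrite (odotC MV mone) (odot1 MV) (asboolT (erefl _)).
  case: asboolP => [->|_].
    rewrite (odotC MV) (odot0 MV) chain_pair_step; congr pair.
    by rewrite GRing.addrAC.
  by rewrite GRing.addrAC.
rewrite -[RHS]/(h (m, a) (n, b)).
transitivity (h (qrepr (pair m a)) (qrepr (pair n b))).
  by rewrite /chain_add /h; case: (qrepr (pair m a)); case: (qrepr (pair n b)).
rewrite (chain_pair_lift (h := h^~ (qrepr (pair n b))) (hP _)) hC.
by rewrite (chain_pair_lift (h := h^~ (m, a)) (hP _)) hC.
Qed.

Lemma chain_addC : commutative (@chain_add C).
Proof.
move=> x y; have [m [a ->]] := chain_carP x; have [n [b ->]] := chain_carP y.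
by rewrite !chain_addE (mv_plusC MV a) (odotC MV a) (GRing.addrC m).
Qed.

(** Since the three digits on the right-hand side are symmetric in the summands,
    associativity can be read off this formula. *)
Lemma chain_add3E m a n b k c :
  chain_add (chain_add (pair m a) (pair n b)) (pair k c) =
  if `[< (a (+) b (+) c)%mv = mone >] then
    if `[< (carry3 a b c)%mv = mone >] then pair (m + n + k + 1 + 1)%R (a (&) b (&) c)
    else pair (m + n + k + 1)%R (carry3 a b c)
  else pair (m + n + k)%R (a (+) b (+) c).
Proof.
rewrite chain_addE /carry3; case: asboolP => ab.
  rewrite chain_addE ab (mv_1plus MV) (asboolT (erefl _)).
  rewrite (odotC MV mone) (odot1 MV) (mv_plusC MV c).
  by rewrite (GRing.addrAC _ 1%R).
have {}ab' : a (&) b = mzero.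
  have [/(oplus_eq1 MV)//|ba] := chain_total a^m b.
  exact/(mle_negr MV).
rewrite chain_addE ab' (mv_plus0 MV); case: asboolP => // abc.
by case: asboolP => // /(odot_eq1 MV).
Qed.

Lemma chain_addA : associative (@chain_add C).
Proof.
move=> x y z; rewrite [LHS]chain_addC.
have [m [a ->]] := chain_carP x; have [n [b ->]] := chain_carP y.
have [k [c ->]] := chain_carP z; rewrite !chain_add3E.
rewrite -carry3_rot -!(mv_plusA MV) -!(odotA MV) !(mv_plusC MV a).
rewrite !(odotC MV a) !(mv_plusA MV) !(odotA MV) -(GRing.addrA m) (GRing.addrC m).
by [].
Qed.

Lemma chain_addp0 m a n : chain_add (pair m a) (pair n mzero) = pair (m + n)%R a.
Proof.
rewrite chain_addE (mv_plus0 MV) (odot0 MV).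
by case: asboolP => [->|//]; rewrite chain_pair_step.
Qed.

Lemma chain_add0 : left_id (chain_zero C) (@chain_add C).
Proof.
move=> x; have [m [a ->]] := chain_carP x.
by rewrite chain_addC chain_addp0 GRing.addr0.
Qed.

Lemma chain_oppE m a : chain_opp (pair m a) = pair (- m - 1)%R a^m.
Proof.
pose h (p : pre_sharp C) := pair (- p.1 - 1)%R (p.2)^m.
transitivity (h (qrepr (pair m a))).
  by rewrite /chain_opp /h; case: (qrepr (pair m a)).
apply: (chain_pair_lift (h := h)) => k; rewrite /h /=.
by rewrite (mv_n1 MV) -chain_pair_step GRing.opprD GRing.subrK.
Qed.

Lemma chain_addN : left_inverse (chain_zero C) (@chain_opp C) (@chain_add C).
Proof.
move=> x; have [m [a ->]] := chain_carP x.
rewrite chain_oppE chain_addE (mv_nplus MV) (asboolT (erefl _)).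
by rewrite odotE (ominus_self MV) GRing.addrAC GRing.subrK GRing.addNr.
Qed.

End ChainGroup.

(** A name for the carrier on which the group structure is declared, the proof
    that [C] is a chain being part of the type. *)
Definition cgroup (C : pmv_chain) : Type := chain_car C.

HB.instance Definition _ (C : pmv_chain) := gen_eqMixin (cgroup C).
HB.instance Definition _ (C : pmv_chain) := gen_choiceMixin (cgroup C).
HB.instance Definition _ (C : pmv_chain) := GRing.isZmodule.Build (cgroup C)
  (@chain_addA C) (@chain_addC C) (@chain_add0 C) (@chain_addN C).

Section ChainRing.
Variable C : pmv_chain.
Implicit Types (a b c : C) (m n k : int) (x y z : cgroup C).
Import Order.TTheory GRing.Theory Num.Theory.
Local Open Scope ring_scope.
Local Open Scope mv_scope.

Let PMV : is_pmvf C := chain_pmvf C.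
Let MV : is_mv C := pmvf_mv PMV.

Local Notation pair := (@chain_pair C : int -> C -> cgroup C).

Definition iota_chain a : cgroup C := pair 0 a.
Local Notation iota := iota_chain.
Local Notation U := (iota mone).

Lemma chain_zmulE k x : chain_zmul k x = x *~ k.
Proof.
have iterE (n : nat) : iter n (chain_add x) (chain_zero C) = x *+ n.
  by elim: n => [|n IH] //=; rewrite IH mulrS.
case: k => n; rewrite /chain_zmul iterE // NegzE mulrNz.
Qed.

Lemma iota0 : iota mzero = 0.
Proof. by []. Qed.

Lemma iotaD a b : a <=m b^m -> iota (a (+) b) = iota a + iota b.
Proof.
move=> ab; apply/esym; rewrite [LHS](chain_addE 0 a 0 b) [a (&) b]ab.
by case: asboolP => [->|//]; rewrite chain_pair_step.
Qed.

Lemma iotaB a b : b <=m a -> iota (a (-) b) = iota a - iota b.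
Proof.
move=> ba; rewrite {2}(mle_oplusE MV ba) iotaD ?addrK //.
by rewrite (odot_ominus MV) (odotC MV); apply: odot_le.
Qed.

Lemma iotaN a : iota a^m = U - iota a.
Proof.
rewrite -iotaB; last exact: mle1.
by rewrite (odot_ominus MV) (odotC MV) (odot1 MV).
Qed.

Lemma chain_pairE m a : pair m a = U *~ m + iota a.
Proof.
have pairD k n b : pair (k + n) b = pair n mzero + pair k b.
  by rewrite [RHS]addrC; apply/esym/chain_addp0.
have -> : pair m a = pair m mzero + iota a by rewrite -pairD add0r.
congr (_ + _); have pair1 : U = pair 1 mzero.
  by rewrite [LHS](esym (chain_pair_step C 0)) add0r.
elim/int_ind: m => [|n IH|n IH]; first by rewrite mulr0z.
  by rewrite -addn1 PoszD pairD -pair1 IH mulrzDr addrC.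
rewrite -addn1 PoszD opprD mulrzDr -IH mulrNz mulr1z; apply/eqP.
by rewrite eq_sym subr_eq pair1 -pairD addrC addrNK.
Qed.

Lemma cgroupP x : exists m a, x = U *~ m + iota a.
Proof.
have [m [a ->]] := chain_carP x; exists m, a; exact: chain_pairE.
Qed.

(** A map [g] on the chain that is additive as long as sums do not overflow has an
    additive extension [F] to the group. When [a + b] does overflow, [a] is the sum of [a (&) b] and the
    complement of [b], whence [g a + g b = g mone + g (a (&) b)]. *)
Lemma chain_ext_additive (H : zmodType) (g : C -> H) (F : cgroup C -> H) :
  (forall a b, a <=m b^m -> g (a (+) b) = g a + g b) ->
  (forall m a, F (U *~ m + iota a) = g mone *~ m + g a) ->
  forall x y, F (x + y) = F x + F y.
Proof.
move=> gD FE x y; have [m [a ->]] := cgroupP x; have [n [b ->]] := cgroupP y.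
rewrite !FE [in RHS]addrACA -mulrzDr -!chain_pairE.
rewrite [pair m a + _](chain_addE m a n b); case: asboolP => ab.
  rewrite chain_pairE FE [in LHS]mulrzDr -addrA mulr1z; congr (_ + _).
  have ba : b^m <=m a by apply/(oplus_eq1 MV); rewrite (mv_plusC MV).
  have {1}-> : mone = b^m (+) b by rewrite (mv_nplus MV).
  rewrite gD; last exact: mle_refl.
  have {2}-> : a = (a (&) b) (+) b^m by rewrite {1}(mle_oplusE MV ba) odotE.
  rewrite gD; first by rewrite addrC addrA.
  by rewrite (mv_nK MV) (odotC MV); apply: odot_le.
rewrite chain_pairE FE gD //.
have [/(oplus_eq1 MV)//|ba] := chain_total a^m b.
exact/(mle_negr MV).
Qed.

Lemma mprod_mono a b c : a <=m b -> mprod c a <=m mprod c b.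
Proof. by rewrite /mle -(pmvf_mulB PMV) => ->; rewrite (pmvf_mul0 PMV). Qed.

(** By the axiom on differences: [a] is [(a + b) - b] when [a + b] does not
    overflow. *)
Lemma iota_mprodD a b c : a <=m b^m ->
  iota (mprod (a (+) b) c) = iota (mprod a c) + iota (mprod b c).
Proof.
move=> ab; rewrite !(pmvf_mulC PMV _ c).
rewrite -{2}(oplusK_le MV ab) (pmvf_mulB PMV) iotaB ?subrK //.
by apply: mprod_mono; apply: mle_plusl.
Qed.

Definition cmul x y : cgroup C := chain_mul x y.

Lemma chain_mulE m a n b :
  cmul (U *~ m + iota a : cgroup C) (U *~ n + iota b : cgroup C) =
  iota (mprod mone mone) *~ (m * n) + iota (mprod b mone) *~ m
  + iota (mprod a mone) *~ n + iota (mprod a b).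
Proof.
pose h (p q : pre_sharp C) : cgroup C :=
  iota (mprod mone mone) *~ (p.1 * q.1) + iota (mprod q.2 mone) *~ p.1
  + iota (mprod p.2 mone) *~ q.1 + iota (mprod p.2 q.2).
have hC p q : h p q = h q p.
  rewrite /h (pmvf_mulC PMV p.2 q.2) (mulrC p.1 q.1); congr (_ + _).
  exact: addrAC.
have hP q k : h ((k + 1)%R, mzero) q = h (k, mone) q.
  case: q => [l d]; rewrite /h /= !(pmvf_mulC PMV mzero) !(pmvf_mul0 PMV) iota0.
  rewrite mul0rz !addr0 mulrDl mul1r !mulrzDr mulr1z (pmvf_mulC PMV d).
  by rewrite addrACA addrA.
rewrite -!chain_pairE -[RHS]/(h (m, a) (n, b)).
transitivity (h (qrepr (pair m a)) (qrepr (pair n b))).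
  rewrite /cmul /chain_mul /h; case: (qrepr (pair m a)) => k c.
  by case: (qrepr (pair n b)) => l d; rewrite !chain_zmulE.
rewrite (chain_pair_lift (h := h^~ (qrepr (pair n b))) (hP _)) hC.
by rewrite (chain_pair_lift (h := h^~ (m, a)) (hP _)) hC.
Qed.

Lemma chain_mulC x y : cmul x y = cmul y x.
Proof.
have [m [a ->]] := cgroupP x; have [n [b ->]] := cgroupP y.
rewrite !chain_mulE (pmvf_mulC PMV a b) (mulrC m n); congr (_ + _).
exact: addrAC.
Qed.

Lemma chain_mulDl x y z :
  cmul (x + y) z = cmul x z + cmul y z.
Proof.
have [n [b ->]] := cgroupP z.
pose g a := iota (mprod a mone) *~ n + iota (mprod a b).
apply: (@chain_ext_additive _ g (cmul^~ _)).
  by move=> a c ac; rewrite /g !iota_mprodD // mulrzDl addrACA.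
move=> m a; rewrite chain_mulE /g mulrzDl -mulrzA mulrC -!addrA.
by rewrite (pmvf_mulC PMV b).
Qed.

Lemma chain_mulDr x y z :
  cmul z (x + y) = cmul z x + cmul z y.
Proof. by rewrite !(chain_mulC z) chain_mulDl. Qed.

Lemma chain_mulNl x y : cmul (- x) y = - cmul x y.
Proof.
have m0 : cmul 0 y = 0.
  by apply: (@addIr _ (cmul 0 y)); rewrite -chain_mulDl !add0r.
by apply/eqP; rewrite -addr_eq0 -chain_mulDl addNr m0.
Qed.

Lemma chain_mulNr x y : cmul y (- x) = - cmul y x.
Proof. by rewrite !(chain_mulC y) chain_mulNl. Qed.

Lemma chain_mul_iota a b : cmul (iota a) (iota b) = iota (mprod a b).
Proof.
have := chain_mulE 0 a 0 b.
by rewrite !mulr0z !add0r.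
Qed.

Lemma cgroup_ind (P : cgroup C -> Prop) :
  (forall x y, P x -> P y -> P (x + y)) -> (forall x, P x -> P (- x)) ->
  (forall a, P (iota a)) -> forall x, P x.
Proof.
move=> PD PN Pi x; have [m [a ->]] := cgroupP x; apply: (PD) => //.
have Pn (n : nat) : P (U *+ n).
  by elim: n => [|n IH]; [exact: (Pi mzero) | rewrite mulrS; exact: PD].
by case: m => n; rewrite ?NegzE ?mulrNz; [exact: Pn | exact/PN/Pn].
Qed.

Lemma chain_mulA x y z :
  cmul x (cmul y z) = cmul (cmul x y) z.
Proof.
elim/cgroup_ind: x => [x1 x2 e1 e2|x e|a].
- by rewrite !chain_mulDl e1 e2.
- by rewrite !chain_mulNl e.
elim/cgroup_ind: y => [y1 y2 e1 e2|y e|b].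
- by rewrite !(chain_mulDl, chain_mulDr) e1 e2.
- by rewrite !(chain_mulNl, chain_mulNr) e.
elim/cgroup_ind: z => [z1 z2 e1 e2|z e|c].
- by rewrite !chain_mulDr e1 e2.
- by rewrite !chain_mulNr e.
by rewrite !chain_mul_iota (pmvf_mulA PMV).
Qed.

End ChainRing.

(** If the unit is zero the group is trivial; otherwise an element has a unique
    representative whose second entry is not the unit. *)
Section ChainOrder.
Variable C : pmv_chain.
Implicit Types (a b c : C) (m n k : int) (x y z : cgroup C).
Import Order.TTheory GRing.Theory Num.Theory.
Local Open Scope ring_scope.
Local Open Scope mv_scope.

Let PMV : is_pmvf C := chain_pmvf C.
Let MV : is_mv C := pmvf_mv PMV.

Local Notation pair := (@chain_pair C : int -> C -> cgroup C).
Local Notation iota := (@iota_chain C).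
Local Notation U := (iota mone).

Lemma chain_trivial x y : mone = mzero :> C -> x = y.
Proof.
move=> triv; have iota_eq0 a : iota a = 0.
  by rewrite -(mv_plus0 MV a) -triv (mv_plus1 MV) triv.
have [m [a ->]] := cgroupP x; have [n [b ->]] := cgroupP y.
by rewrite !iota_eq0 !mul0rz.
Qed.

Hypothesis (nontrivial : mone <> mzero :> C).

Lemma chain_pair_inj m n a b : a <> mone -> b <> mone ->
  pair m a = pair n b -> m = n /\ a = b.
Proof.
pose h (p : pre_sharp C) : pre_sharp C :=
  if `[< p.2 = mone >] then ((p.1 + 1)%R, mzero) else p.
move=> /asboolPn/negbTE a1 /asboolPn/negbTE b1.
move=> /(chain_pair_eq (h := h)); rewrite /h /= a1 b1 => H.
suff [-> ->] : (m, a) = (n, b) by [].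
by apply: H => k; rewrite (asboolF (nesym nontrivial)) (asboolT (erefl _)).
Qed.

Lemma chain_pair_normal x : exists m a, x = pair m a /\ a <> mone.
Proof.
have [m [a ->]] := chain_carP x; have [->|?] := pselect (a = mone).
  by exists (m + 1), mzero; rewrite chain_pair_step; split => //; apply: nesym.
by exists m, a.
Qed.

End ChainOrder.

Section ChainLring.
Variable C : pmv_chain.
Implicit Types (a b c : C) (m n k : int) (x y z : cgroup C).
Import Order.TTheory GRing.Theory Num.Theory.
Local Open Scope ring_scope.
Local Open Scope mv_scope.

Let PMV : is_pmvf C := chain_pmvf C.
Let MV : is_mv C := pmvf_mv PMV.

Local Notation pair := (@chain_pair C : int -> C -> cgroup C).
Local Notation iota := (@iota_chain C).
Local Notation U := (iota mone).

Lemma iota_chain_inj : injective iota.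
Proof.
have one_inj b : mone <> mzero :> C -> iota mone = iota b -> b = mone.
  move=> nt; apply: contraPP => b1; rewrite [iota mone](esym (chain_pair_step C 0)).
  by move=> /(chain_pair_inj nt (nesym nt) b1)[].
move=> a b ab; have [triv|nt] := pselect (mone = mzero :> C).
  by rewrite -(mv_plus0 MV a) -(mv_plus0 MV b) -triv !(mv_plus1 MV).
have [a1|a1] := pselect (a = mone).
  by rewrite a1 in ab *; apply/esym/one_inj.
have [b1|b1] := pselect (b = mone); last by have [] := chain_pair_inj nt a1 b1 ab.
by rewrite b1 in ab *; apply: one_inj => //; apply: esym.
Qed.

(** The positive cone of the order, described by some representative instead of
    the normal one, so that its closure under sums needs no normalization. *)
Definition cpos x := exists (m : nat) a, x = U *+ m + iota a.

Lemma cpos_iota a : cpos (iota a).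
Proof. by exists 0%N, a; rewrite add0r. Qed.

Lemma cpos0 : cpos 0. Proof. exact: (cpos_iota mzero). Qed.

Lemma cpos_iotaD a b : cpos (iota a + iota b).
Proof.
rewrite [iota a + _](chain_addE 0 a 0 b); case: asboolP => _.
  by exists 1%N, (a (&) b); apply: chain_pairE.
exact: cpos_iota.
Qed.

Lemma cposD x y : cpos x -> cpos y -> cpos (x + y).
Proof.
move=> [m [a ->]] [n [b ->]]; rewrite addrACA -mulrnDr.
have [k [c ->]] := cpos_iotaD a b; rewrite addrA -mulrnDr.
by exists (m + n + k)%N, c.
Qed.

Lemma cposMn x (n : nat) : cpos x -> cpos (x *+ n).
Proof.
move=> px; elim: n => [|n IH]; first exact: cpos0.
by rewrite mulrS; apply: cposD.
Qed.

Lemma cpos_total x : cpos x \/ cpos (- x).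
Proof.
have [[m|m] [a ->]] := cgroupP x; first by left; exists m, a.
right; exists m, a^m; rewrite iotaN NegzE mulrNz opprD opprK.
by rewrite -pmulrn mulrSr addrA.
Qed.

Lemma cpos_pair m a : mone <> mzero :> C -> a <> mone ->
  cpos (pair m a) <-> (0 <= m)%R.
Proof.
move=> nt a1; split=> [[n [b]]|]; last first.
  by case: m => // m _; exists m, a; rewrite chain_pairE.
have -> : U *+ n + iota b = pair n b by rewrite chain_pairE.
have [->|b1] := pselect (b = mone).
  by rewrite -chain_pair_step => /(chain_pair_inj nt a1 (nesym nt))[->].
by move=> /(chain_pair_inj nt a1 b1)[->].
Qed.

Lemma cpos_anti x : cpos x -> cpos (- x) -> x = 0.
Proof.
have [/chain_trivial triv _ _|nt] := pselect (mone = mzero :> C); first exact: triv.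
have [m [a [-> a1]]] := chain_pair_normal nt x.
move=> /(cpos_pair _ nt a1) m0.
rewrite chain_pairE opprD -[- iota a](addKr U) -iotaN.
have -> : - (U *~ m) + (- U + iota a^m) = pair (- (m + 1)) a^m.
  by rewrite chain_pairE mulrNz mulrzDr mulr1z opprD addrA.
have [->|a0] := pselect (a = mzero).
  rewrite (mv_n0 C) -chain_pair_step opprD addrNK => /(cpos_pair _ nt (nesym nt)).
  rewrite oppr_ge0 => m0'; have -> : m = 0 by apply/eqP; rewrite eq_le m0 m0'.
  by rewrite mulr0z add0r.
have a1' : a^m <> mone by move=> /(congr1 (@mneg C)); rewrite (mv_nK MV) (mv_n1 MV).
move=> /(cpos_pair _ nt a1'); rewrite oppr_ge0 => m1.
by move: m1; rewrite leNgt ltzD1 m0.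
Qed.

Lemma cpos_diff m n a b : mone <> mzero :> C -> a <> mone -> b <> mone ->
  cpos (pair n b - pair m a) <-> ((m < n)%R \/ (m = n /\ a <=m b)).
Proof.
move=> nt a1 b1; rewrite !chain_pairE opprD addrACA -mulrNz -mulrzDr.
have [ab|nab] := pselect (a <=m b).
  rewrite -iotaB // -chain_pairE cpos_pair //; last first.
    by rewrite (odot_ominus MV) => /(odot_eq1 MV).
  by rewrite subr_ge0 le_eqVlt; split=> [/orP[/eqP|]|[->|[-> _]]];
    rewrite ?eqxx ?orbT //; [right | left].
have [//|ba] := chain_total a b.
rewrite -[iota b - _]opprB -iotaB // -[- iota _](addKr U) -iotaN.
have -> : U *~ (n - m) + (- U + iota (a (-) b)^m) = pair (n - m - 1) (a (-) b)^m.
  by rewrite chain_pairE [in RHS]mulrzDr mulrNz mulr1z addrA.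
rewrite cpos_pair //; last first.
  move=> /(congr1 (@mneg C)); rewrite (mv_nK MV) (mv_n1 MV); exact: nab.
rewrite subr_ge0 -[1%R]add0r lezD1 subr_gt0; split=> [|[|[]//]]; first by left.
by [].
Qed.

Lemma chain_leE x y : chain_le x y <-> cpos (y - x).
Proof.
have [triv|nt] := pselect (mone = mzero :> C).
  split=> _; first by rewrite (chain_trivial (y - x) 0 triv); apply: cpos0.
  move=> m n a b _ _ a1 _; case: a1.
  by rewrite -(mv_plus0 MV a) -triv (mv_plus1 MV).
split=> [le_xy|pos_yx m n a b xE yE a1 b1]; last first.
  by apply/(cpos_diff _ _ nt a1 b1); rewrite -xE -yE.
have [m [a [xE a1]]] := chain_pair_normal nt x.
have [n [b [yE b1]]] := chain_pair_normal nt y.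
by rewrite xE yE; apply/cpos_diff => //; apply: le_xy.
Qed.

Lemma chain_le_total x y : chain_le x y \/ chain_le y x.
Proof. by rewrite !chain_leE -(opprB y x); apply: cpos_total. Qed.

Lemma chain_cmul_pos x y : cpos x -> cpos y -> cpos (cmul x y).
Proof.
move=> [m [a ->]] [n [b ->]].
have := chain_mulE m a n b; rewrite -!pmulrn => ->.
by repeat (apply: cposD); try apply: cposMn; apply: cpos_iota.
Qed.

Lemma chain_sharp_lring : is_lring (chain_sharp C).
Proof.
have le_refl x : chain_le x x by apply/chain_leE; rewrite subrr; apply: cpos0.
have le_trans y x z : chain_le x y -> chain_le y z -> chain_le x z.
  move=> /chain_leE xy /chain_leE yz; apply/chain_leE.
  by rewrite -(subrK y z) -addrA; apply: cposD.
split.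
- exact: chain_addA.
- exact: chain_addC.
- exact: chain_add0.
- exact: chain_addN.
- exact: chain_mulA.
- exact: chain_mulC.
- exact: chain_mulDl.
- exact: le_refl.
- move=> x y /chain_leE xy /chain_leE yx; apply: esym.
  by apply: (@subr0_eq (cgroup C)); apply: cpos_anti xy _; rewrite opprB.
- move=> x y z; exact: le_trans.
- move=> x y z /=; case: asboolP => [xy|nxy].
    by split=> [zx|[]//]; split=> //; apply: le_trans xy.
  have [//|yx] := chain_le_total x y.
  by split=> [zy|[]//]; split=> //; apply: le_trans yx.
- move=> x y z /=; case: asboolP => [xy|nxy].
    by split=> [yz|[]//]; split=> //; apply: le_trans yz.
  have [//|yx] := chain_le_total x y.
  by split=> [xz|[]//]; split=> //; apply: le_trans xz.
- move=> x y z /chain_leE xy; apply/chain_leE.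
  rewrite -[X in cpos X]/((y : cgroup C) + (z : cgroup C)
    - ((x : cgroup C) + (z : cgroup C))).
  by rewrite opprD addrACA subrr addr0.
move=> x y /chain_leE x0 /chain_leE y0; apply/chain_leE; rewrite subr0.
by apply: chain_cmul_pos; [move: x0 | move: y0]; rewrite subr0.
Qed.

End ChainLring.

(** * Lattice-ordered groups *)

Record lring := Lring { lring_sig :> lu_sig; lring_ax : is_lring lring_sig }.

(** The carrier of a ring, for declaring its additive group; the order, lattice
    and product operations are restated on it below to keep this type. *)
Definition lgroup (S : lring) : Type := S.

HB.instance Definition _ (S : lring) := gen_eqMixin (lgroup S).
HB.instance Definition _ (S : lring) := gen_choiceMixin (lgroup S).
HB.instance Definition _ (S : lring) := GRing.isZmodule.Build (lgroup S)
  (l_addA (lring_ax S)) (l_addC (lring_ax S)) (l_add0 (lring_ax S))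
  (l_addN (lring_ax S)).

Definition lg_le (S : lring) (x y : lgroup S) : Prop := lle x y.
Definition lg_meet (S : lring) (x y : lgroup S) : lgroup S := lmeet x y.
Definition lg_join (S : lring) (x y : lgroup S) : lgroup S := ljoin x y.
Definition lg_mul (S : lring) (x y : lgroup S) : lgroup S := lmul x y.
Definition lg_unit (S : lring) : lgroup S := lunit.

Declare Scope lgroup_scope.
Delimit Scope lgroup_scope with lg.
Local Notation "x <=l y" := (lg_le x y) (at level 70, no associativity) :
  lgroup_scope.
Local Notation "x `&` y" := (lg_meet x y) : lgroup_scope.
Local Notation "x `|` y" := (lg_join x y) : lgroup_scope.

Section LGroup.
Variable S : lring.
Implicit Types x y z t a w : lgroup S.
Import GRing.Theory.
Local Open Scope ring_scope.
Local Open Scope lgroup_scope.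

Let L : is_lring S := lring_ax S.

Lemma lg_refl x : x <=l x. Proof. exact: (l_lexx L). Qed.

Lemma lg_anti x y : x <=l y -> y <=l x -> x = y.
Proof. exact: (l_le_anti L). Qed.

Lemma lg_trans y x z : x <=l y -> y <=l z -> x <=l z.
Proof. exact: (l_le_trans L). Qed.

Lemma lg_le_meetE x y z : z <=l x `&` y <-> z <=l x /\ z <=l y.
Proof. exact: (l_le_meet L). Qed.

Lemma lg_join_leE x y z : x `|` y <=l z <-> x <=l z /\ y <=l z.
Proof. exact: (l_join_le L). Qed.

Lemma lg_meet_lel x y : x `&` y <=l x.
Proof. by have [] := (lg_le_meetE x y _).1 (lg_refl _). Qed.

Lemma lg_meet_ler x y : x `&` y <=l y.
Proof. by have [] := (lg_le_meetE x y _).1 (lg_refl _). Qed.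

Lemma lg_join_gel x y : x <=l x `|` y.
Proof. by have [] := (lg_join_leE x y _).1 (lg_refl _). Qed.

Lemma lg_join_ger x y : y <=l x `|` y.
Proof. by have [] := (lg_join_leE x y _).1 (lg_refl _). Qed.

Lemma lg_le_meet x y z : z <=l x -> z <=l y -> z <=l x `&` y.
Proof. by move=> *; apply/lg_le_meetE. Qed.

Lemma lg_join_le x y z : x <=l z -> y <=l z -> x `|` y <=l z.
Proof. by move=> *; apply/lg_join_leE. Qed.

Lemma lg_leD2r z x y : x <=l y -> x + z <=l y + z.
Proof. exact: (l_le_add L). Qed.

Lemma lg_leD x y z t : x <=l y -> z <=l t -> x + z <=l y + t.
Proof.
move=> xy zt; apply: lg_trans (lg_leD2r z xy) _.
by rewrite !(addrC y); apply: lg_leD2r.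
Qed.

Lemma lg_leBr x y z : x <=l y - z <-> x + z <=l y.
Proof.
split; first by move=> /(lg_leD2r z); rewrite subrK.
by move=> /(lg_leD2r (- z)); rewrite addrK.
Qed.

Lemma lg_leBl x y z : x - z <=l y <-> x <=l y + z.
Proof.
split; first by move=> /(lg_leD2r z); rewrite subrK.
by move=> /(lg_leD2r (- z)); rewrite addrK.
Qed.

Lemma lg_sub_ge0 x y : 0 <=l y - x <-> x <=l y.
Proof. by rewrite lg_leBr add0r. Qed.

Lemma lg_leN x y : x <=l y -> - y <=l - x.
Proof. by move=> /lg_sub_ge0 xy; apply/lg_sub_ge0; rewrite opprK addrC. Qed.

Lemma lg_le_addl x y : 0 <=l y -> x <=l x + y.
Proof. by move=> y0; rewrite -{1}[x]addr0; apply: lg_leD y0; apply: lg_refl. Qed.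

Lemma lg_le_addr x y : 0 <=l y -> x <=l y + x.
Proof. by rewrite addrC; apply: lg_le_addl. Qed.

Lemma lg_ge0D x y : 0 <=l x -> 0 <=l y -> 0 <=l x + y.
Proof. by move=> x0 /(lg_le_addl x); apply: lg_trans. Qed.

Lemma lg_meetC x y : x `&` y = y `&` x.
Proof.
by apply: lg_anti; apply: lg_le_meet; (exact: lg_meet_ler || exact: lg_meet_lel).
Qed.

Lemma lg_joinC x y : x `|` y = y `|` x.
Proof.
by apply: lg_anti; apply: lg_join_le; (exact: lg_join_ger || exact: lg_join_gel).
Qed.

Lemma lg_meetA x y z : x `&` (y `&` z) = x `&` y `&` z.
Proof.
have lel := lg_meet_lel; have ler := lg_meet_ler; apply: lg_anti.
  apply: lg_le_meet; first by apply: lg_le_meet => //; apply: lg_trans (ler _ _) _.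
  exact: lg_trans (ler _ _) (ler _ _).
apply: lg_le_meet; first exact: lg_trans (lel _ _) (lel _ _).
by apply: lg_le_meet => //; apply: lg_trans (lel _ _) _.
Qed.

Lemma lg_meet_l x y : x <=l y -> x `&` y = x.
Proof.
move=> xy; apply: lg_anti; first exact: lg_meet_lel.
by apply: lg_le_meet xy; apply: lg_refl.
Qed.

Lemma lg_meet_r x y : y <=l x -> x `&` y = y.
Proof. by move=> yx; rewrite lg_meetC lg_meet_l. Qed.

Lemma lg_join_r x y : x <=l y -> x `|` y = y.
Proof.
move=> xy; apply: lg_anti; last exact: lg_join_ger.
by apply: lg_join_le xy _; apply: lg_refl.
Qed.

Lemma lg_join_l x y : y <=l x -> x `|` y = x.
Proof. by move=> yx; rewrite lg_joinC lg_join_r. Qed.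

Lemma lg_meet_mono x y z t : x <=l y -> z <=l t -> x `&` z <=l y `&` t.
Proof.
move=> xy zt; apply: lg_le_meet; first exact: lg_trans (lg_meet_lel _ _) xy.
exact: lg_trans (lg_meet_ler _ _) zt.
Qed.

Lemma lg_join_mono x y z t : x <=l y -> z <=l t -> x `|` z <=l y `|` t.
Proof.
move=> xy zt; apply: lg_join_le; first exact: lg_trans xy (lg_join_gel _ _).
exact: lg_trans zt (lg_join_ger _ _).
Qed.

Lemma lg_meetDr x y z : (x `&` y) + z = (x + z) `&` (y + z).
Proof.
apply: lg_anti.
  by apply: lg_le_meet; apply: lg_leD2r; [exact: lg_meet_lel | exact: lg_meet_ler].
by apply/lg_leBl/lg_le_meet; apply/lg_leBl; [exact: lg_meet_lel | exact: lg_meet_ler].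
Qed.

Lemma lg_joinDr x y z : (x `|` y) + z = (x + z) `|` (y + z).
Proof.
apply: lg_anti; last first.
  by apply: lg_join_le; apply: lg_leD2r; [exact: lg_join_gel | exact: lg_join_ger].
by apply/lg_leBr/lg_join_le; apply/lg_leBr; [exact: lg_join_gel | exact: lg_join_ger].
Qed.

Lemma lg_oppI x y : - (x `&` y) = (- x) `|` (- y).
Proof.
apply: lg_anti; last first.
  by apply: lg_join_le; apply: lg_leN; [exact: lg_meet_lel | exact: lg_meet_ler].
rewrite -[X in _ <=l X]opprK; apply: lg_leN.
by apply: lg_le_meet; rewrite -[X in _ <=l X]opprK; apply: lg_leN;
  [exact: lg_join_gel | exact: lg_join_ger].
Qed.

Lemma lg_oppU x y : - (x `|` y) = (- x) `&` (- y).
Proof. by rewrite -{1}[x]opprK -{1}[y]opprK -lg_oppI opprK. Qed.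

Lemma lg_addIU x y : (x `&` y) + (x `|` y) = x + y.
Proof.
apply: (canLR (subrK _)); rewrite lg_oppU [RHS]addrC lg_meetDr.
by rewrite addKr [- y + _]addrC addrK lg_meetC.
Qed.

(** Each of [y] and [z] is at most [d + (x `|` (y `|` z)) - x], where [d] is the
    right-hand side, hence so is their join. *)
Lemma lg_meetUr x y z : x `&` (y `|` z) = (x `&` y) `|` (x `&` z).
Proof.
apply: lg_anti; last first.
  by apply: lg_join_le; apply: lg_meet_mono (lg_refl x) _;
    [exact: lg_join_gel | exact: lg_join_ger].
set d := (x `&` y) `|` _; set e := x `|` (y `|` z).
have bound t : x `&` t <=l d -> t <=l y `|` z -> t <=l d + e - x.
  move=> td te; apply/lg_leBr; rewrite [t + x]addrC -(lg_addIU x t).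
  by apply: lg_leD td _; apply: lg_join_mono te; apply: lg_refl.
have yz : y `|` z <=l d + e - x.
  by apply: lg_join_le; apply: bound;
    (exact: lg_join_gel || exact: lg_join_ger).
move: yz => /lg_leBr; rewrite [(_ `|` _) + x]addrC -(lg_addIU x) -/e.
by move=> /(lg_leD2r (- e)); rewrite !addrK.
Qed.

Lemma lg_joinIr x y z : x `|` (y `&` z) = (x `|` y) `&` (x `|` z).
Proof. by apply: oppr_inj; rewrite lg_oppU !lg_oppI !lg_oppU lg_meetUr. Qed.

Lemma lg_joinIl x y z : (y `&` z) `|` x = (y `|` x) `&` (z `|` x).
Proof. by rewrite !(lg_joinC _ x) lg_joinIr. Qed.

Lemma lg_joinUl x y z : (x `|` y) `|` z = (x `|` z) `|` (y `|` z).
Proof.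
have gel := lg_join_gel; have ger := lg_join_ger; apply: lg_anti.
  apply: lg_join_le; first exact: lg_join_mono.
  exact: lg_trans (ger _ _) (ger _ _).
by apply: lg_join_le; apply: lg_join_mono (lg_refl z).
Qed.

(** ** Truncation to the unit interval *)

Variable u : lgroup S.
Hypothesis u_ge0 : 0 <=l u.

Definition clip_at x := (x `|` 0) `&` u.
Local Notation clip := clip_at.

Lemma clip_ge0 x : 0 <=l clip x.
Proof. by apply: lg_le_meet => //; apply: lg_join_ger. Qed.

Lemma clip_le x : clip x <=l u.
Proof. exact: lg_meet_ler. Qed.

Lemma clip_id x : 0 <=l x -> x <=l u -> clip x = x.
Proof. by move=> x0 xu; rewrite /clip_at lg_join_l ?lg_meet_l. Qed.

Lemma clip_le0 x : x <=l 0 -> clip x = 0.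
Proof. by move=> x0; rewrite /clip_at lg_join_r ?lg_meet_l. Qed.

Lemma clip_geu x : u <=l x -> clip x = u.
Proof.
move=> ux; rewrite /clip_at lg_join_l ?lg_meet_r //; exact: lg_trans ux.
Qed.

Lemma clipU x y : clip (x `|` y) = clip x `|` clip y.
Proof. by rewrite /clip_at lg_joinUl !(lg_meetC _ u) lg_meetUr. Qed.

Lemma clipI x y : clip (x `&` y) = clip x `&` clip y.
Proof.
rewrite /clip_at lg_joinIl -!lg_meetA; congr (_ `&` _).
rewrite (lg_meetC u) -lg_meetA; congr (_ `&` _).
by rewrite lg_meet_l //; apply: lg_refl.
Qed.

(** On a chain: if [x >= 0] both sides are [x + a], and if [x <= 0] both are the
    positive part of [x + a]. *)
Let pos_shift x a : 0 <=l a ->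
  (x `|` 0) + (((x + a) `|` 0) `&` a) = (x + a) `|` 0.
Proof.
move=> a0; set q := (x + a) `|` 0; set m := q `&` a.
have x0 : 0 <=l x `|` 0 := lg_join_ger _ _.
apply: lg_anti.
  rewrite lg_joinDr add0r; apply: lg_join_le; last exact: lg_meet_lel.
  apply: lg_trans (lg_join_gel _ _); rewrite !(addrC x).
  exact/lg_leD2r/lg_meet_ler.
rewrite addrC lg_meetDr; apply: lg_le_meet; first exact: lg_le_addl.
apply: lg_join_le; last exact: lg_ge0D.
by rewrite addrC; apply: lg_leD (lg_refl _) (lg_join_gel _ _).
Qed.

(** The digit of [x + a] at a place is the truncated sum of the digit of [x] at
    that place and of the overflow of [a] when it is added to the digit of [x] at
    the place below, which is the truncation of [x + u]. *)
Lemma clip_carry x a : 0 <=l a -> a <=l u ->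
  clip (x + a) = (clip x + ((clip (x + u) + a - u) `|` 0)) `&` u.
Proof.
move=> a0 au.
have -> : (clip (x + u) + a - u) `|` 0 = ((x + a) `|` 0) `&` a.
  rewrite /clip_at -addrA lg_meetDr lg_joinDr add0r addrACA subrr addr0.
  rewrite (addrC u) subrK lg_joinIl lg_joinUl (lg_join_r (_ : a - u <=l 0)).
    by rewrite (lg_join_l (lg_join_ger _ _)) (lg_join_l a0).
  by apply/lg_leBl; rewrite add0r.
rewrite [clip x]/clip_at lg_meetDr pos_shift // -lg_meetA.
rewrite (lg_meet_r (_ : u <=l _)) //; apply: lg_le_addl.
by apply: lg_le_meet => //; apply: lg_join_ger.
Qed.

(** This adds one digit to a partial expansion of [y]. *)
Lemma clip_step y w : y `&` (u + w) = (y `&` w) + clip (y - w).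
Proof.
rewrite [RHS]addrC /clip_at lg_meetDr; set v := _ `|` 0.
have -> : v + (y `&` w) = y.
  rewrite /v -[X in _ `|` X](subrr w) -lg_joinDr addrAC [(_ `|` _) + _]addrC.
  by rewrite lg_addIU addrK.
rewrite [u + (_ `&` _)]addrC lg_meetDr lg_meetA.
by rewrite (lg_meet_l (lg_le_addl _ u_ge0)) [w + u]addrC.
Qed.

End LGroup.

Section LringMul.
Variable S : lring.
Implicit Types x y z : lgroup S.
Import GRing.Theory.
Local Open Scope ring_scope.
Local Open Scope lgroup_scope.

Let L : is_lring S := lring_ax S.

Lemma lg_mulDl x y z : lg_mul (x + y) z = lg_mul x z + lg_mul y z.
Proof. exact: (l_mulD L). Qed.

Lemma lg_mulC x y : lg_mul x y = lg_mul y x.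
Proof. exact: (l_mulC L). Qed.

Lemma lg_mulDr x y z : lg_mul z (x + y) = lg_mul z x + lg_mul z y.
Proof. by rewrite !(lg_mulC z) lg_mulDl. Qed.

Lemma lg_mul0l x : lg_mul 0 x = 0.
Proof. by apply: (@addIr _ (lg_mul 0 x)); rewrite -lg_mulDl !add0r. Qed.

Lemma lg_mulNl x y : lg_mul (- x) y = - lg_mul x y.
Proof. by apply/eqP; rewrite -addr_eq0 -lg_mulDl addNr lg_mul0l. Qed.

Lemma lg_mulBr x y z : lg_mul z (x - y) = lg_mul z x - lg_mul z y.
Proof. by rewrite lg_mulDr (lg_mulC z (- y)) lg_mulNl (lg_mulC y). Qed.

Lemma lg_mul_ge0 x y : 0 <=l x -> 0 <=l y -> 0 <=l lg_mul x y.
Proof. exact: (l_mul_ge0 L). Qed.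

Lemma lg_mul_mono z x y : 0 <=l z -> x <=l y -> lg_mul z x <=l lg_mul z y.
Proof.
move=> z0 /lg_sub_ge0 xy; apply/lg_sub_ge0; rewrite -lg_mulBr.
exact: lg_mul_ge0.
Qed.

Lemma lg_negpart x : (- x) `|` 0 = (x `|` 0) - x.
Proof. by rewrite lg_joinDr subrr sub0r lg_joinC. Qed.

Lemma lg_pos_disjoint x : (x `|` 0) `&` ((- x) `|` 0) = 0.
Proof.
rewrite lg_negpart -[X in X `&` _]add0r [(x `|` 0) - x]addrC -lg_meetDr.
by rewrite -[X in X `&` _]oppr0 -lg_oppU lg_joinC addNr.
Qed.

End LringMul.

(** ** Unary expansions *)

Section Expansion.
Variable S : lring.
Implicit Types x y z : lgroup S.
Import Order.TTheory GRing.Theory Num.Theory.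
Local Open Scope ring_scope.
Local Open Scope lgroup_scope.

Local Notation u := (lg_unit S).
Local Notation clip := (clip_at u).
Hypothesis u_ge0 : 0 <=l u.

Definition lg_bounded x := exists n : nat, - (u *+ n) <=l x /\ x <=l u *+ n.

Lemma mulrn_unit_ge0 (n : nat) : 0 <=l u *+ n.
Proof.
by elim: n => [|n IH]; [exact: lg_refl | rewrite mulrS; apply: lg_ge0D].
Qed.

Lemma mulrn_unit_le (m n : nat) : (m <= n)%N -> u *+ m <=l u *+ n.
Proof. by move=> /subnKC <-; rewrite mulrnDr; apply/lg_le_addl/mulrn_unit_ge0. Qed.

Lemma lg_bounded_le x (m n : nat) : (m <= n)%N ->
  - (u *+ m) <=l x -> x <=l u *+ m -> - (u *+ n) <=l x /\ x <=l u *+ n.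
Proof.
move=> /mulrn_unit_le mn lx xu; split; last exact: lg_trans xu mn.
exact: lg_trans (lg_leN mn) lx.
Qed.

Lemma lg_bounded2 x y : lg_bounded x -> lg_bounded y -> exists n : nat,
  (- (u *+ n) <=l x /\ x <=l u *+ n) /\ (- (u *+ n) <=l y /\ y <=l u *+ n).
Proof.
move=> [m [lx xu]] [n [ly yu]]; exists (m + n)%N.
split; first by apply: lg_bounded_le lx xu; rewrite leq_addr.
by apply: lg_bounded_le ly yu; rewrite leq_addl.
Qed.

Lemma lg_boundedI x y : lg_bounded x -> lg_bounded y -> lg_bounded (x `&` y).
Proof.
move=> /lg_bounded2/[apply][[n [[lx xu] [ly yu]]]]; exists n; split.
  exact: lg_le_meet.
exact: lg_trans (lg_meet_lel _ _) xu.
Qed.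

Lemma lg_boundedU x y : lg_bounded x -> lg_bounded y -> lg_bounded (x `|` y).
Proof.
move=> /lg_bounded2/[apply][[n [[lx xu] [ly yu]]]]; exists n; split.
  exact: lg_trans lx (lg_join_gel _ _).
exact: lg_join_le.
Qed.

Lemma lg_boundedD x y : lg_bounded x -> lg_bounded y -> lg_bounded (x + y).
Proof.
move=> [m [lx xu]] [n [ly yu]]; exists (m + n)%N; rewrite mulrnDr opprD.
by split; apply: lg_leD.
Qed.

Lemma lg_boundedN x : lg_bounded x -> lg_bounded (- x).
Proof.
move=> [n [lx xu]]; exists n; split; first exact: lg_leN.
by rewrite -[X in _ <=l X]opprK; apply: lg_leN.
Qed.

Lemma lg_bounded_unit x : 0 <=l x -> x <=l u -> lg_bounded x.
Proof.
move=> x0 xu; exists 1%N; split=> //; apply: lg_trans x0.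
by rewrite -oppr0; apply: lg_leN.
Qed.

Lemma meet_unit_sum z (n : nat) : 0 <=l z ->
  z `&` (u *+ n) = \sum_(i < n) clip (z - u *+ i).
Proof.
move=> z0; elim: n => [|n IH]; first by rewrite big_ord0 lg_meet_r.
by rewrite big_ord_recr /= -IH mulrS clip_step.
Qed.

(** Translating [x] by [u *+ n] puts it between 0 and [u *+ (n + n)], so that its
    digits outside of this range contribute nothing. *)
Lemma unary_expansion x (n : nat) : - (u *+ n) <=l x -> x <=l u *+ n ->
  x = \sum_(i < n + n) clip (x - u *~ (i%:Z - n%:Z)) - u *+ n.
Proof.
move=> lx xu; apply/eqP; rewrite eq_sym subr_eq; apply/eqP.
rewrite -[RHS](lg_meet_l (y := u *+ (n + n))); last first.
  by rewrite mulrnDr; apply: lg_leD2r.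
rewrite meet_unit_sum; last by rewrite -[u *+ n]opprK; apply/lg_leBr; rewrite add0r.
apply: eq_bigr => i _; congr (clip _).
by rewrite mulrzBr opprB -!pmulrn addrA.
Qed.

Lemma clip_inj x y : lg_bounded x -> lg_bounded y ->
  (forall k : int, clip (x - u *~ k) = clip (y - u *~ k)) -> x = y.
Proof.
move=> /lg_bounded2/[apply][[n [[lx xu] [ly yu]]]] xy.
rewrite (unary_expansion lx xu) (unary_expansion ly yu); congr (_ - _).
exact: eq_bigr.
Qed.

End Expansion.

(** * Maps of an algebra into the unit interval of a ring *)

Section GammaMap.
Variables (A : pmv_sig) (HA : is_pmvf A) (S : lring).
Implicit Types (x y z : lgroup S) (a b c : A).
Import Order.TTheory GRing.Theory Num.Theory.
Local Open Scope ring_scope.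
Local Open Scope mv_scope.
Local Open Scope lgroup_scope.

Local Notation u := (lg_unit S).
Local Notation clip := (clip_at u).
Let MV : is_mv A := pmvf_mv HA.
Let L : is_lring S := lring_ax S.

(** A homomorphism into the unit interval of a ring that may lack a strong unit,
    such as an infinite product. *)
Record gamma_map (f : A -> lgroup S) : Prop := GammaMap {
  gm_ge0 : forall a, 0 <=l f a;
  gm_one : f mone = u;
  gm_plus : forall a b, f (a (+) b)%mv = (f a + f b) `&` u;
  gm_neg : forall a, f (a^m)%mv = u - f a;
  gm_mul : forall a b, f (mprod a b) = lg_mul (f a) (f b) }.

Variables (f : A -> lgroup S) (Hf : gamma_map f).

Lemma gm_unit_ge0 : 0 <=l u.
Proof. by rewrite -(gm_one Hf); apply: (gm_ge0 Hf). Qed.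

Lemma gm_le_unit a : f a <=l u.
Proof. by apply/lg_sub_ge0; rewrite -gm_neg //; apply: (gm_ge0 Hf). Qed.

Lemma gm_zero : f mzero = 0.
Proof. by rewrite -(mv_n1 MV) (gm_neg Hf) (gm_one Hf) subrr. Qed.

Lemma gm_odot a b : f (a (&) b)%mv = (f a + f b - u) `|` 0.
Proof.
rewrite /odot (gm_neg Hf) (gm_plus Hf) !(gm_neg Hf).
have -> : f a + f b - u = - (u - f a + (u - f b)) + u.
  by rewrite opprD !opprB [in RHS]addrA subrK addrAC.
by rewrite -[X in _ `|` X](addNr u) -lg_joinDr -lg_oppI addrC.
Qed.

Lemma gm_ominus a b : f (a (-) b)%mv = (f a - f b) `|` 0.
Proof.
rewrite /ominus (gm_neg Hf) (gm_plus Hf) (gm_neg Hf).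
have -> : f a - f b = - (u - f a + f b) + u.
  by rewrite opprD opprB [in RHS]addrAC subrK.
by rewrite -[X in _ `|` X](addNr u) -lg_joinDr -lg_oppI addrC.
Qed.

Lemma gm_mono a b : (a <=m b)%mv -> f a <=l f b.
Proof.
move=> /(mle_oplusE MV) ->; rewrite (gm_plus Hf); apply: lg_le_meet (gm_le_unit _).
by apply: lg_le_addr; apply: (gm_ge0 Hf).
Qed.

Lemma gm_meet a b : f (mmeet a b) = f a `&` f b.
Proof.
rewrite /mmeet gm_odot (gm_plus Hf) (gm_neg Hf).
have -> : f a + ((u - f a + f b) `&` u) - u = f b `&` f a.
  rewrite [f a + _]addrC -addrA lg_meetDr [u + (f a - u)]addrC subrK.
  by rewrite -[f a - u]opprB addrAC subrr add0r.
by rewrite lg_join_l ?(lg_meetC (f b)) //; apply: lg_le_meet; apply: (gm_ge0 Hf).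
Qed.

Lemma gm_join a b : f (oplus (ominus a b) b) = f a `|` f b.
Proof.
rewrite (gm_plus Hf) gm_ominus lg_joinDr subrK add0r lg_meet_l //.
by apply: lg_join_le; apply: gm_le_unit.
Qed.

Inductive gspan : lgroup S -> Prop :=
| gspan0 : gspan 0
| gspan_add x a : gspan x -> gspan (x + f a)
| gspan_sub x a : gspan x -> gspan (x - f a).

Lemma gspan_val a : gspan (f a).
Proof. by rewrite -[f a]add0r; apply/gspan_add/gspan0. Qed.

Lemma gspanD x y : gspan x -> gspan y -> gspan (x + y).
Proof.
move=> Gx; elim=> [|{}y a _ IH|{}y a _ IH]; first by rewrite addr0.
  by rewrite addrA; apply: gspan_add.
by rewrite addrA; apply: gspan_sub.
Qed.

Lemma gspanN x : gspan x -> gspan (- x).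
Proof.
elim=> [|{}x a _ IH|{}x a _ IH]; first by rewrite oppr0; apply: gspan0.
  by rewrite opprD; apply: gspan_sub.
by rewrite opprD opprK; apply: gspan_add.
Qed.

Lemma gspanMn x (n : nat) : gspan x -> gspan (x *+ n).
Proof.
move=> Gx; elim: n => [|n IH]; first exact: gspan0.
by rewrite mulrS; apply: gspanD.
Qed.

Lemma gspanM x y : gspan x -> gspan y -> gspan (lg_mul x y).
Proof.
move=> Gx Gy; have fM a : gspan (lg_mul (f a) y).
  elim: Gy => [|{}y b _ IH|{}y b _ IH].
  - by rewrite lg_mulC lg_mul0l; apply: gspan0.
  - by rewrite lg_mulDr -(gm_mul Hf); apply: gspan_add.
  by rewrite lg_mulBr -(gm_mul Hf); apply: gspan_sub.
elim: Gx => [|{}x a _ IH|{}x a _ IH].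
- by rewrite lg_mul0l; apply: gspan0.
- by rewrite lg_mulDl; apply: gspanD.
by rewrite lg_mulDl lg_mulNl; apply: gspanD => //; apply: gspanN.
Qed.

(** These elements form a sublattice, since truncation preserves meets and
    joins, whereas [gspan] is visibly a subring. The two agree: a bounded element
    is the sum of its digits up to a multiple of [u], and adding a value of [f]
    changes digits by the carry rule, whose right-hand side is a value of [f]. *)
Definition digital x :=
  lg_bounded x /\ forall k : int, exists a, clip (x - u *~ k) = f a.

Lemma digital_gspan x : digital x -> gspan x.
Proof.
move=> [[n [lx xu]] dx]; rewrite (unary_expansion gm_unit_ge0 lx xu).
apply: gspanD; last by apply/gspanN/gspanMn; rewrite -(gm_one Hf); apply: gspan_val.
elim/big_ind: _ => [|y z|i _]; [exact: gspan0 | exact: gspanD | ].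
by have [a ->] := dx (i%:Z - n%:Z); apply: gspan_val.
Qed.

Lemma gm_bounded a : lg_bounded (f a).
Proof.
by apply: lg_bounded_unit; [exact: gm_unit_ge0 | exact: (gm_ge0 Hf) |
  exact: gm_le_unit].
Qed.

Lemma digital_add x a : digital x -> digital (x + f a).
Proof.
move=> [bx dx]; split.
  by apply: lg_boundedD => //; apply: gm_bounded.
move=> k; have [b xk] := dx k; have [c xk1] := dx (k - 1).
exists (b (+) (c (&) a))%mv; rewrite (gm_plus Hf) gm_odot -xk -xk1.
rewrite addrAC (clip_carry _ (gm_ge0 Hf a) (gm_le_unit a)).
by rewrite mulrzBr opprB mulr1z [u - _]addrC addrA.
Qed.

(** Translation by [u] renumbers the digits. *)
Lemma digital_shift x : digital (x + u) -> digital x.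
Proof.
move=> [bx dx]; split.
  rewrite -(addrK u x); apply: lg_boundedD => //; apply: lg_boundedN.
  by apply: lg_bounded_unit; [exact: gm_unit_ge0 | exact: gm_unit_ge0 |
    exact: lg_refl].
move=> k; have [b xk] := dx (k + 1); exists b; rewrite -xk.
by rewrite mulrzDr mulr1z opprD addrACA subrr addr0.
Qed.

Lemma digital_sub x a : digital x -> digital (x - f a).
Proof.
move=> /(@digital_add _ (a^m)%mv); rewrite (gm_neg Hf) => dx.
by apply: digital_shift; rewrite -addrA [- _ + u]addrC.
Qed.

Lemma gspan_digital x : gspan x -> digital x.
Proof.
elim=> [|{}x a _ IH|{}x a _ IH]; [|exact: digital_add|exact: digital_sub].
split.
  by apply: lg_bounded_unit; [exact: gm_unit_ge0 | exact: lg_refl |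
    exact: gm_unit_ge0].
move=> k; have [k0|k0] := leP 0 k.
  exists mzero; rewrite gm_zero clip_le0 //; first exact: gm_unit_ge0.
  rewrite add0r -oppr0; apply: lg_leN; case: k k0 => // n _.
  exact: mulrn_unit_ge0 gm_unit_ge0 n.
exists mone; rewrite (gm_one Hf) clip_geu //; first exact: gm_unit_ge0.
case: k k0 => // n _; rewrite add0r NegzE mulrNz opprK -pmulrn mulrS.
exact/lg_le_addl/mulrn_unit_ge0/gm_unit_ge0.
Qed.

(** Meets and joins go through [digital], the other operations do not. *)
Lemma lring_gen_gspan x : lring_gen (range f) x -> gspan x.
Proof.
elim=> {x} [_ [a _ <-]||x y _ Gx _ Gy|x _ Gx|x y _ Gx _ Gy|x y _ Gx _ Gy|x y _ Gx _ Gy].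
- exact: gspan_val.
- exact: gspan0.
- exact: gspanD.
- exact: gspanN.
- exact: gspanM.
- apply: digital_gspan.
  have [[bx dx] [bz dy]] := (gspan_digital Gx, gspan_digital Gy).
  split; first exact: lg_boundedI gm_unit_ge0 _ _ bx bz.
  move=> k; have [[a xa] [b yb]] := (dx k, dy k); exists (mmeet a b).
  by rewrite lg_meetDr clipI gm_meet xa yb.
apply: digital_gspan.
have [[bx dx] [bz dy]] := (gspan_digital Gx, gspan_digital Gy).
split; first exact: lg_boundedU gm_unit_ge0 _ _ bx bz.
move=> k; have [[a xa] [b yb]] := (dx k, dy k).
exists (oplus (ominus a b) b).
by rewrite lg_joinDr clipU gm_join xa yb.
Qed.

End GammaMap.

(** * The algebra of the unit interval *)

Lemma sig_eq (T : Type) (P : T -> Prop) (x y : {x : T | P x}) :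
  sval x = sval y -> x = y.
Proof. by case: x y => [x Px] [y Py] /= e; apply: eq_exist. Qed.

Section Gamma.
Variable R : lru.
Import GRing.Theory.
Local Open Scope ring_scope.
Local Open Scope mv_scope.
Local Open Scope lgroup_scope.

Definition lru_ring : lring := Lring (lru_lring (lruP R)).

Definition Gamma_val (x : Gamma_sig R) : lgroup lru_ring := sval x.
Local Notation v := Gamma_val.
Local Notation u := (lg_unit lru_ring).

Let u_ge0 : 0 <=l u. Proof. exact: lru_unit_ge0 (lruP R). Qed.

Lemma Gamma_val_inj : injective v.
Proof. by move=> x y; apply: sig_eq. Qed.

Lemma Gamma_val_map : gamma_map v.
Proof.
split=> //; first by move=> [x []].
exact: (subr0 (u : lgroup lru_ring)).
Qed.

Let v_ge0 x : 0 <=l v x := gm_ge0 Gamma_val_map x.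
Let v_le x : v x <=l u := gm_le_unit Gamma_val_map x.

Lemma Gamma_mleE (x y : Gamma_sig R) : (x <=m y)%mv <-> v x <=l v y.
Proof.
have e : v (x (-) y)%mv = (v x - v y) `|` 0 := gm_ominus Gamma_val_map x y.
split=> [xy|xy].
  have := lg_join_gel (v x - v y) 0; rewrite -e xy => /lg_leBl.
  by rewrite -[v mzero]/(0 : lgroup lru_ring) add0r.
apply: Gamma_val_inj; rewrite e lg_join_r //.
by apply/lg_leBl; rewrite add0r.
Qed.

Let trunc_add (x y : lgroup lru_ring) : 0 <=l x ->
  ((y `&` u) + x) `&` u = (y + x) `&` u.
Proof.
move=> x0; rewrite lg_meetDr -lg_meetA (lg_meet_r (_ : u <=l u + x)) //.
exact: lg_le_addl.
Qed.

(** A semi-low ring is an f-ring on its unit interval: multiplication by [a]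
    keeps the positive and negative parts of [b - c] disjoint. *)
Let mul_pos (a b c : Gamma_sig R) :
  lg_mul (v a) ((v b - v c) `|` 0) = (lg_mul (v a) (v b) - lg_mul (v a) (v c)) `|` 0.
Proof.
pose p := b (-) c; pose n := c (-) b.
have pE : v p = (v b - v c) `|` 0 := gm_ominus Gamma_val_map b c.
have nE : v n = (v c - v b) `|` 0 := gm_ominus Gamma_val_map c b.
have pn0 : v p `&` v n = 0.
  by rewrite pE nE -[v c - v b]opprB lg_pos_disjoint.
have pnE : v b - v c = v p - v n.
  by rewrite pE nE -[v c - v b]opprB lg_negpart subKr.
have mul_le (d : Gamma_sig R) : lg_mul (v a) (v d) <=l v d.
  have := lru_semilow (lruP R) (svalP a) (svalP d).
  by move=> /(l_le_meet (lru_lring (lruP R)))[].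
have apn0 : lg_mul (v a) (v p) `&` lg_mul (v a) (v n) = 0.
  apply: lg_anti; first by rewrite -pn0; apply: lg_meet_mono.
  by apply: lg_le_meet; apply: lg_mul_ge0.
rewrite -pE -!lg_mulBr pnE lg_mulBr -[X in _ `|` X](subrr (lg_mul (v a) (v n))).
(* As the meet is zero, the join is the sum. *)
by rewrite -lg_joinDr -[_ `|` _]add0r -apn0 lg_addIU addrK.
Qed.

Lemma Gamma_pmvf : is_pmvf (Gamma_sig R).
Proof.
have G := Gamma_val_map; have plusE := gm_plus G; have negE := gm_neg G.
have mulE := gm_mul G; have v0 : v mzero = 0 by [].
have plusC x y : oplus x y = oplus y x :> Gamma_sig R.
  by apply: Gamma_val_inj; rewrite !plusE addrC.
split; first split.
- move=> x y z; apply: Gamma_val_inj; rewrite (plusC x) !plusE !trunc_add //.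
  by rewrite addrC addrA.
- exact: plusC.
- by move=> x; apply: Gamma_val_inj; rewrite plusE v0 add0r lg_meet_l.
- by move=> x; apply: Gamma_val_inj; rewrite !negE opprB addrC subrK.
- move=> x; apply: Gamma_val_inj; rewrite plusE negE v0 subr0 lg_meet_r //.
  exact: lg_le_addr.
- move=> x y; apply: Gamma_val_inj; rewrite !plusE.
  rewrite ![v (mneg (oplus (mneg _) _))](gm_ominus G) !lg_joinDr !subrK !add0r.
  by rewrite lg_joinC.
- move=> x y z; apply: Gamma_val_inj.
  exact: (l_mulA (lru_lring (lruP R))).
- by move=> x y; apply: Gamma_val_inj; rewrite !mulE lg_mulC.
- by move=> x; apply: Gamma_val_inj; rewrite mulE v0 lg_mulC lg_mul0l.
- move=> a b c; apply/Gamma_mleE; rewrite plusE; apply: lg_le_meet => //.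
  rewrite !mulE plusE -lg_mulDr; apply: lg_mul_mono => //; exact: lg_meet_lel.
- move=> a b; apply/Gamma_mleE; rewrite (gm_meet G).
  exact: lru_semilow (lruP R) _ _ (svalP a) (svalP b).
move=> a b c; apply: Gamma_val_inj.
by rewrite mulE !(gm_ominus G) !mulE mul_pos.
Qed.

End Gamma.

(** * The ring of an algebra *)

Lemma lu_prod_lring (I : Type) (R : I -> lu_sig) :
  (forall i, is_lring (R i)) -> is_lring (lu_prod R).
Proof.
move=> L; have ext (x y : forall i, R i) : (forall i, x i = y i) -> x = y.
  exact: functional_extensionality_dep.
split=> /=.
- by move=> x y z; apply: ext => i; apply: (l_addA (L i)).
- by move=> x y; apply: ext => i; apply: (l_addC (L i)).
- by move=> x; apply: ext => i; apply: (l_add0 (L i)).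
- by move=> x; apply: ext => i; apply: (l_addN (L i)).
- by move=> x y z; apply: ext => i; apply: (l_mulA (L i)).
- by move=> x y; apply: ext => i; apply: (l_mulC (L i)).
- by move=> x y z; apply: ext => i; apply: (l_mulD (L i)).
- by move=> x i; apply: (l_lexx (L i)).
- by move=> x y xy yx; apply: ext => i; apply: (l_le_anti (L i)).
- by move=> x y z xy yz i; apply: (l_le_trans (L i)) (xy i) (yz i).
- move=> x y z; split=> [h|[zx zy] i].
    by split=> i; have [] := (l_le_meet (L i) _ _ _).1 (h i).
  by apply/(l_le_meet (L i)).
- move=> x y z; split=> [h|[xz yz] i].
    by split=> i; have [] := (l_join_le (L i) _ _ _).1 (h i).
  by apply/(l_join_le (L i)).
- by move=> x y z xy i; apply: (l_le_add (L i)).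
by move=> x y x0 y0 i; apply: (l_mul_ge0 (L i)).
Qed.

Lemma lu_gen_lring (R : lu_sig) (B : set R) (u : {x : R | lring_gen B x}) :
  is_lring R -> is_lring (lu_gen u).
Proof.
move=> L; split=> /=.
- by move=> x y z; apply: sig_eq; apply: (l_addA L).
- by move=> x y; apply: sig_eq; apply: (l_addC L).
- by move=> x; apply: sig_eq; apply: (l_add0 L).
- by move=> x; apply: sig_eq; apply: (l_addN L).
- by move=> x y z; apply: sig_eq; apply: (l_mulA L).
- by move=> x y; apply: sig_eq; apply: (l_mulC L).
- by move=> x y z; apply: sig_eq; apply: (l_mulD L).
- by move=> x; apply: (l_lexx L).
- by move=> x y xy yx; apply: sig_eq; apply: (l_le_anti L).
- by move=> x y z; apply: (l_le_trans L).
- by move=> x y z; apply: (l_le_meet L).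
- by move=> x y z; apply: (l_join_le L).
- by move=> x y z; apply: (l_le_add L).
by move=> x y; apply: (l_mul_ge0 L).
Qed.

Lemma iota_gamma_map (C : pmv_chain) :
  @gamma_map C (Lring (chain_sharp_lring C)) (@iota_chain C).
Proof.
have MV := pmvf_mv (chain_pmvf C).
pose S := Lring (chain_sharp_lring C).
pose i (a : C) : lgroup S := iota_chain a.
have ge0 a : lg_le 0%R (i a).
  apply/chain_leE; rewrite GRing.subr0; exact: cpos_iota.
have negE a : i (a^m)%mv = (lg_unit S - i a)%R by exact: iotaN.
have le_unit a : lg_le (i a) (lg_unit S).
  by apply/lg_sub_ge0; rewrite -negE.
split=> //.
- move=> a b; apply/esym.
  have -> : (iota_chain a + iota_chain b)%R =
    chain_add (chain_pair 0%R a) (chain_pair 0%R b) by [].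
  rewrite chain_addE; case: asboolP => [->|_]; last exact: (lg_meet_l (le_unit _)).
  apply: lg_meet_r; have -> : chain_pair (0 + 0 + 1)%R (a (&) b)%mv =
    (lg_unit S + i (a (&) b)%mv)%R.
    by rewrite chain_pairE.
  exact: lg_le_addl.
by move=> a b; rewrite -chain_mul_iota.
Qed.

Section Sharp.
Variable A : pmvf.
Import GRing.Theory.

Let HA : is_pmvf A := pmvfP A.
Let MV : is_mv A := pmvf_mv HA.

Definition spec_chain (P : Spec A) : pmv_chain :=
  PmvChain (pmv_quotP HA (prime_ideal (svalP P))) (prime_quot_total HA (svalP P)).

Lemma sharp_prod_lring : is_lring (sharp_prod A).
Proof. by apply: lu_prod_lring => P; apply: (chain_sharp_lring (spec_chain P)). Qed.

Definition sharp_prod_ring : lring := Lring sharp_prod_lring.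

Lemma hat_gamma_map : @gamma_map A sharp_prod_ring (@hat A).
Proof.
have iP (P : Spec A) := iota_gamma_map (spec_chain P).
have JP (P : Spec A) := prime_ideal (svalP P).
split.
- by move=> a P; apply: (gm_ge0 (iP P)).
- apply: functional_extensionality_dep => P.
  by congr chain_pair; apply/esym/(pclassN HA (JP P)).
- move=> a b; apply: functional_extensionality_dep => P.
  have := gm_plus (iP P) (pclass (sval P) a) (pclass (sval P) b).
  by rewrite (pclassD HA (JP P)).
- move=> a; apply: functional_extensionality_dep => P.
  have := gm_neg (iP P) (pclass (sval P) a).
  by rewrite (pclassN HA (JP P)).
move=> a b; apply: functional_extensionality_dep => P.
have := gm_mul (iP P) (pclass (sval P) a) (pclass (sval P) b).
by rewrite (pclassM HA (JP P)).
Qed.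

(** Two elements with the same image are congruent modulo all primes, so that
    their distance, contained in every prime ideal, vanishes. *)
Lemma hat_inj : injective (@hat A).
Proof.
move=> a b ab; set d := oplus (ominus a b) (ominus b a).
suff d0 : d = mzero.
  apply: (mle_anti MV); first exact: (oplus_eq0 MV d0).
  by move: d0; rewrite /d (mv_plusC MV) => d0; apply: (oplus_eq0 MV d0).
apply: contrapT => /(prime_separates MV)[P [HP]]; apply.
pose Q : Spec A := exist _ P HP; have JP := prime_ideal HP.
apply/(pclass_eq HA JP).
exact: (@iota_chain_inj (spec_chain Q) _ _ (congr1 (@^~ Q) ab)).
Qed.

(** The subring generated by [A] is all digital, which gives it a strong
    unit and shows that [A] fills its unit interval. *)
Lemma sharp_digital (x : sharp_sig A) :
  @digital A sharp_prod_ring (@hat A) (sval x).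
Proof.
apply: (gspan_digital HA hat_gamma_map).
exact: (lring_gen_gspan HA hat_gamma_map (svalP x)).
Qed.

Lemma sharp_lring : is_lring (sharp_sig A).
Proof. exact/lu_gen_lring/sharp_prod_lring. Qed.

Lemma sharp_hat_unit_interval (a : A) : lunit_interval (sharp_hat a).
Proof.
split; first exact: (gm_ge0 hat_gamma_map).
by have := gm_le_unit hat_gamma_map a; rewrite -(gm_one hat_gamma_map).
Qed.

Lemma sharp_unit_intervalP (x : sharp_sig A) :
  lunit_interval x -> exists a, x = sharp_hat a.
Proof.
move=> [x0 xu]; have [_ /(_ 0%R)[a]] := sharp_digital x.
rewrite mulr0z subr0 clip_id // => [e|]; first by exists a; apply: sig_eq.
by move: xu; rewrite /lg_le -(gm_one hat_gamma_map).
Qed.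

Lemma sharp_lru : is_lru (sharp_sig A).
Proof.
have G := hat_gamma_map; have L := sharp_lring.
split=> //.
- by have [] := sharp_hat_unit_interval mone.
- move=> x; have [[n [lx xu]] _] := sharp_digital x; exists n.
  have iterE : sval (iter n (ladd (@lunit (sharp_sig A))) lzero)
    = (lg_unit sharp_prod_ring *+ n)%R :> lgroup sharp_prod_ring.
    elim: n {lx xu} => [|n IH] //=; rewrite mulrS -IH -(gm_one G).
    by [].
  rewrite /lle /= iterE; apply: (@lg_join_le sharp_prod_ring) => //.
  by rewrite -[X in lg_le _ X]opprK; apply: lg_leN.
move=> x y /sharp_unit_intervalP[a ->] /sharp_unit_intervalP[b ->].
have -> : lmul (sharp_hat a) (sharp_hat b) = sharp_hat (mprod a b).
  exact/sig_eq/esym/(gm_mul G).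
apply/(l_le_meet L); split; apply: (gm_mono HA G).
  exact: mprod_lel.
exact: mprod_ler.
Qed.

End Sharp.

(** * The universal property *)

Definition lu_pair (R S : lu_sig) : lu_sig :=
  @LuSig (R * S)%type
    (fun p q => (ladd p.1 q.1, ladd p.2 q.2)) (lzero, lzero)
    (fun p => (lopp p.1, lopp p.2))
    (fun p q => (lmul p.1 q.1, lmul p.2 q.2))
    (fun p q => lle p.1 q.1 /\ lle p.2 q.2)
    (fun p q => (lmeet p.1 q.1, lmeet p.2 q.2))
    (fun p q => (ljoin p.1 q.1, ljoin p.2 q.2))
    (lunit, lunit).

Lemma lu_pair_lring (R S : lu_sig) :
  is_lring R -> is_lring S -> is_lring (lu_pair R S).
Proof.
move=> LR LS; split=> /=.
- by move=> x y z /=; rewrite (l_addA LR) (l_addA LS).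
- by move=> x y /=; rewrite (l_addC LR) (l_addC LS).
- by move=> [x y] /=; rewrite (l_add0 LR) (l_add0 LS).
- by move=> x /=; rewrite (l_addN LR) (l_addN LS).
- by move=> x y z /=; rewrite (l_mulA LR) (l_mulA LS).
- by move=> x y /=; rewrite (l_mulC LR) (l_mulC LS).
- by move=> x y z /=; rewrite (l_mulD LR) (l_mulD LS).
- by move=> x; split; [apply: (l_lexx LR) | apply: (l_lexx LS)].
- move=> [x y] [x' y'] /= [xx' yy'] [x'x y'y].
  by rewrite (l_le_anti LR xx' x'x) (l_le_anti LS yy' y'y).
- move=> x y z [xy1 xy2] [yz1 yz2].
  by split; [apply: (l_le_trans LR) yz1 | apply: (l_le_trans LS) yz2].
- move=> x y z; rewrite (l_le_meet LR) (l_le_meet LS).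
  by split=> [[[? ?] [? ?]]|[[? ?] [? ?]]].
- move=> x y z; rewrite (l_join_le LR) (l_join_le LS).
  by split=> [[[? ?] [? ?]]|[[? ?] [? ?]]].
- by move=> x y z [xy1 xy2]; split; [apply: (l_le_add LR) | apply: (l_le_add LS)].
by move=> x y [x1 x2] [y1 y2]; split;
  [apply: (l_mul_ge0 LR) | apply: (l_mul_ge0 LS)].
Qed.

Section Extension.
Variables (A : pmvf) (R : lru) (f : pmv_hom A (Gamma_sig R)).
Import GRing.Theory.

Let HA : is_pmvf A := pmvfP A.

Let pair_ring : lring :=
  Lring (lu_pair_lring (sharp_prod_lring A) (lru_lring (lruP R))).
Let g (a : A) : lgroup pair_ring := (hat a, sval (f a)).

Let g_map : gamma_map g.
Proof.
have H := hat_gamma_map A; have V := Gamma_val_map R.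
have f1 : f mone = mone by rewrite /mone pmv_homN pmv_hom0.
split=> [a||a b|a|a b].
- by split; [apply: (gm_ge0 H) | apply: (gm_ge0 V)].
- by congr pair; [apply: (gm_one H) | rewrite f1; apply: (gm_one V)].
- by congr pair; [apply: (gm_plus H) | rewrite pmv_homD; apply: (gm_plus V)].
- by congr pair; [apply: (gm_neg H) | rewrite pmv_homN; apply: (gm_neg V)].
by congr pair; [apply: (gm_mul H) | rewrite pmv_homM; apply: (gm_mul V)].
Qed.

(** The extension is built as its graph, the subring generated by the pairs
    [g a]: a digit of such a pair is determined by its first component, so the
    graph is functional. *)
Let graph (x : sharp_prod A) (y : R) :=
  lring_gen (range g) ((x, y) : lu_pair (sharp_prod A) R).

Let graph_total (x : sharp_prod A) :
  lring_gen (range (@hat A)) x -> exists y, graph x y.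
Proof.
elim=> [_ [a _ <-]||x1 x2 _ [y1 G1] _ [y2 G2]|x1 _ [y1 G1]|
  x1 x2 _ [y1 G1] _ [y2 G2]|x1 x2 _ [y1 G1] _ [y2 G2]|x1 x2 _ [y1 G1] _ [y2 G2]].
- by exists (sval (f a)); apply: gen_base; exists a.
- by exists lzero; apply: gen_zero.
- by exists (ladd y1 y2); apply: (gen_add G1 G2).
- by exists (lopp y1); apply: (gen_opp G1).
- by exists (lmul y1 y2); apply: (gen_mul G1 G2).
- by exists (lmeet y1 y2); apply: (gen_meet G1 G2).
by exists (ljoin y1 y2); apply: (gen_join G1 G2).
Qed.

Let graph_fun x y y' : graph x y -> graph x y' -> y = y'.
Proof.
move=> /(lring_gen_gspan HA g_map)/(gspan_digital HA g_map)[bx dx].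
move=> /(lring_gen_gspan HA g_map)/(gspan_digital HA g_map)[bx' dx'].
suff: (x, y) = (x, y') by case.
apply: (clip_inj (gm_unit_ge0 g_map) bx bx') => k.
have [[a ea] [b eb]] := (dx k, dx' k); rewrite ea eb; congr g.
apply: (@hat_inj A).
exact: etrans (esym (congr1 fst ea)) (congr1 fst eb).
Qed.

Lemma sharp_extension :
  exists F : lu_hom (sharp_sig A) R, forall a, F (sharp_hat a) = sval (f a).
Proof.
pose F (x : sharp_sig A) : R := projT1 (cid (graph_total (svalP x))).
have FP x : graph (sval x) (F x) by exact: projT2 (cid (graph_total (svalP x))).
have FE x y : graph (sval x) y -> F x = y by exact: graph_fun.
have Fhat a : F (sharp_hat a) = sval (f a).
  by apply: FE; apply: gen_base; exists a.
have F1 : F lunit = lunit.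
  have -> : @lunit (sharp_sig A) = sharp_hat mone by [].
  by rewrite Fhat /mone pmv_homN pmv_hom0; apply: (gm_one (Gamma_val_map R)).
unshelve eexists (@LuHom _ _ F _ _ _ _ F1) => //.
- by move=> x y; apply: FE; apply: (gen_add (FP x) (FP y)).
- by move=> x y; apply: FE; apply: (gen_mul (FP x) (FP y)).
- by move=> x y; apply: FE; apply: (gen_meet (FP x) (FP y)).
by move=> x y; apply: FE; apply: (gen_join (FP x) (FP y)).
Qed.

Definition sharp_ext : lu_hom (sharp_sig A) R := projT1 (cid sharp_extension).

Lemma sharp_extE a : sharp_ext (sharp_hat a) = sval (f a).
Proof. exact: projT2 (cid sharp_extension) a. Qed.

End Extension.

Section LuHom.
Variables (R S : lring) (phi : lu_hom R S).
Import GRing.Theory.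
Local Open Scope ring_scope.
Let F (x : lgroup R) : lgroup S := phi x.

Lemma lu_hom0 : phi (0 : lgroup R) = (0 : lgroup S).
Proof.
apply: (@addIr (lgroup S) (F 0)).
by have := lu_homD phi (0 : lgroup R) (0 : lgroup R); rewrite [ladd _ _]addr0 add0r.
Qed.

Lemma lu_homN (x : lgroup R) : phi (- x) = (- F x : lgroup S).
Proof.
apply/(@eqP (lgroup S)); rewrite -addr_eq0; apply/eqP.
have := lu_homD phi (- x) x; rewrite [ladd _ _]addNr lu_hom0.
by move=> ->.
Qed.

Lemma lu_homMz (x : lgroup R) (k : int) : phi (x *~ k) = (F x *~ k : lgroup S).
Proof.
have Mn (n : nat) : phi (x *+ n) = (F x *+ n : lgroup S).
  elim: n => [|n IH]; first exact: lu_hom0.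
  by rewrite !mulrS -IH; apply: lu_homD.
by case: k => n; rewrite ?NegzE ?mulrNz -?pmulrn -?Mn // lu_homN.
Qed.

Lemma lu_hom_clip (x : lgroup R) (k : int) :
  phi (clip_at (lg_unit R) (x - lg_unit R *~ k))
  = clip_at (lg_unit S) (F x - lg_unit S *~ k).
Proof.
rewrite /clip_at /lg_meet /lg_join lu_hom_meet lu_hom_join lu_hom_unit lu_hom0.
congr (lmeet (ljoin _ _) _).
rewrite [LHS]lu_homD lu_homN /F lu_homMz /F.
by rewrite [phi (lg_unit R)]lu_hom_unit.
Qed.

Lemma lu_hom_le (x y : R) : lle x y -> lle (phi x) (phi y).
Proof.
move=> xy; have <- : lmeet x y = x by exact: (@lg_meet_l R).
rewrite lu_hom_meet; exact: (@lg_meet_ler S).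
Qed.

End LuHom.

Lemma lru_bounded (R : lru) (x : lgroup (lru_ring R)) : lg_bounded x.
Proof.
have [n xn] := lru_strong (lruP R) x; exists n.
have iterE : iter n (ladd (@lunit R)) lzero
  = (lg_unit (lru_ring R) *+ n)%R :> lgroup (lru_ring R).
  by elim: n {xn} => [|n IH] //=; rewrite GRing.mulrS -IH.
rewrite iterE in xn; have [xu Nxu] := (@lg_join_leE (lru_ring R) _ _ _).1 xn.
by split=> //; rewrite -[x in lg_le _ x]GRing.opprK; apply: lg_leN.
Qed.

Lemma lu_hom_signed_sum (T : Type) (R S : lring) (phi : lu_hom R S) (f : T -> R)
    (s : seq (bool * T)) :
  phi (signed_sum f s) = signed_sum (fun x => phi (f x)) s.
Proof.
rewrite /signed_sum; elim: s => [|[b x] s IH]; first by rewrite !big_nil lu_hom0.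
rewrite !big_cons lu_homD IH; congr ladd; case: b => //=.
exact: lu_homN.
Qed.

(** * The two natural isomorphisms *)

Definition Gamma_obj (R : LRu) : PMVf := PMVfAlg (Gamma_pmvf R).
Definition sharp_obj (A : PMVf) : LRu := LRuRing (sharp_lru A).

Lemma lu_hom_unit_interval (R S : lru) (phi : lu_hom R S) (x : R) :
  lunit_interval x -> lunit_interval (phi x).
Proof.
move=> [x0 xu]; split.
  have := @lu_hom_le (lru_ring R) (lru_ring S) phi _ _ x0.
  by rewrite (@lu_hom0 (lru_ring R) (lru_ring S)).
by rewrite -(lu_hom_unit phi); apply: (@lu_hom_le (lru_ring R) (lru_ring S)).
Qed.

Definition Gamma_hom (R S : lru) (phi : lu_hom R S) :
  pmv_hom (Gamma_sig R) (Gamma_sig S).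
Proof.
exists (fun x => exist _ (phi (sval x)) (lu_hom_unit_interval phi (svalP x))).
- by move=> x y; apply: sig_eq; rewrite /= lu_hom_meet lu_homD lu_hom_unit.
- move=> x; apply: sig_eq; rewrite /= lu_homD lu_hom_unit; congr ladd.
  exact: (@lu_homN (lru_ring R) (lru_ring S)).
- exact/sig_eq/(@lu_hom0 (lru_ring R) (lru_ring S)).
by move=> x y; apply: sig_eq; rewrite /= lu_homM.
Defined.

Definition Gamma_functor : functor Gamma_obj.
Proof.
exists Gamma_hom.
- by move=> R; apply: pmv_hom_ext => x; apply: sig_eq.
by move=> R S T phi psi; apply: pmv_hom_ext => x; apply: sig_eq.
Defined.

Definition alpha (A : PMVf) : arr A (Gamma_obj (sharp_obj A)).
Proof.
exists (fun a : pmvf_sig A => exist _ (sharp_hat a) (sharp_hat_unit_interval a)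
  : Gamma_sig (sharp_obj A)).
- move=> x y; do 2!apply: sig_eq.
  by have := gm_plus (hat_gamma_map A) x y; rewrite -(gm_one (hat_gamma_map A)).
- move=> x; do 2!apply: sig_eq.
  by have := gm_neg (hat_gamma_map A) x; rewrite -(gm_one (hat_gamma_map A)).
- by do 2!apply: sig_eq; apply: (gm_zero (pmvfP A) (hat_gamma_map A)).
by move=> x y; do 2!apply: sig_eq; apply: (gm_mul (hat_gamma_map A)).
Defined.

(** Induction on the generation of the ring of [A] by the values of [sharp_hat],
    whose zero and opposites are preserved as by any additive map. *)
Lemma sharp_hom_ext (A : pmvf) (R : lru) (F G : lu_hom (sharp_sig A) R) :
  (forall a, F (sharp_hat a) = G (sharp_hat a)) -> F = G.
Proof.
move=> FG; apply: lu_hom_ext => -[x Gx].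
pose L := Lring (sharp_lring A).
suff {x Gx}: forall x, lring_gen (range (@hat A)) x ->
  forall Gx, F (exist _ x Gx) = G (exist _ x Gx) by apply; apply: Gx.
have irr x (H H' : lring_gen (range (@hat A)) x) :
  exist _ x H = exist _ x H' :> sharp_sig A.
  exact: sig_eq.
move=> x; elim=> {x} [_ [a _ <-]||x y Gx IHx Gy IHy|x Gx IHx|x y Gx IHx Gy IHy
  |x y Gx IHx Gy IHy|x y Gx IHx Gy IHy] H.
- by rewrite (irr _ H (gen_base (ex_intro2 _ _ a I erefl))); apply: (FG a).
- rewrite (irr _ H (gen_zero _)).
  exact: etrans (@lu_hom0 L (lru_ring R) F) (esym (@lu_hom0 L (lru_ring R) G)).
- rewrite (irr _ H (gen_add Gx Gy)).
  by have := congr2 ladd (IHx Gx) (IHy Gy); rewrite -!lu_homD.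
- rewrite (irr _ H (gen_opp Gx)).
  have := congr1 lopp (IHx Gx).
  have FN := @lu_homN L (lru_ring R) F (exist _ x Gx).
  have GN := @lu_homN L (lru_ring R) G (exist _ x Gx).
  by move=> e; rewrite [LHS]FN [RHS]GN.
- rewrite (irr _ H (gen_mul Gx Gy)).
  by have := congr2 lmul (IHx Gx) (IHy Gy); rewrite -!lu_homM.
- rewrite (irr _ H (gen_meet Gx Gy)).
  by have := congr2 lmeet (IHx Gx) (IHy Gy); rewrite -!lu_hom_meet.
rewrite (irr _ H (gen_join Gx Gy)).
by have := congr2 ljoin (IHx Gx) (IHy Gy); rewrite -!lu_hom_join.
Qed.

Definition sharp_hom (A B : PMVf) (h : arr A B) : arr (sharp_obj A) (sharp_obj B) :=
  sharp_ext (ccomp (alpha B) h).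

Lemma sharp_homE (A B : pmvf) (h : pmv_hom A B) (a : A) :
  lu_fun (sharp_hom h : lu_hom (sharp_sig A) (sharp_sig B)) (sharp_hat a)
  = sharp_hat (h a).
Proof. exact: (@sharp_extE A (sharp_obj B) (ccomp (alpha B) h) a). Qed.

Definition sharp_functor : functor sharp_obj.
Proof.
exists sharp_hom.
- by move=> A; apply: sharp_hom_ext => a; rewrite [LHS]sharp_homE.
move=> A B C h k; apply: sharp_hom_ext => a; rewrite [LHS]sharp_homE.
by rewrite /= !sharp_homE.
Defined.

Definition tau (R : LRu) : arr (sharp_obj (Gamma_obj R)) R :=
  sharp_ext (idm (Gamma_obj R)).

Lemma tauE (R : lru) (x : Gamma_sig R) :
  lu_fun (tau R : lu_hom (sharp_sig (Gamma_sig R)) R) (sharp_hat x) = sval x.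
Proof. exact: (@sharp_extE (Gamma_obj R) R (idm (Gamma_obj R)) x). Qed.

Lemma alpha_inj (A : pmvf) : injective (alpha A : pmv_hom _ _).
Proof. by move=> a b /(congr1 (fun x => sval (sval x)))/hat_inj. Qed.

Lemma alpha_surj (A : pmvf) (x : Gamma_sig (sharp_obj A)) :
  exists a, (alpha A : pmv_hom _ _) a = x.
Proof.
by have [a ea] := sharp_unit_intervalP (svalP x); exists a; apply: sig_eq.
Qed.

(** The digits of [x] lie in the image of [sharp_hat], on which [tau] is
    injective; [tau] preserves digits, and they determine [x]. *)
Lemma tau_inj (R : lru) : injective (tau R : lu_hom _ _).
Proof.
pose Q : lru := sharp_obj (Gamma_obj R).
pose t : lu_hom (lru_ring Q) (lru_ring R) := tau R.
move=> x y txy; apply: (@clip_inj (lru_ring Q)); try exact: lru_bounded.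
  exact: lru_unit_ge0 (lruP Q).
move=> k.
have clip_hat (z : lgroup (lru_ring Q)) : exists a, clip_at (lg_unit _) z = sharp_hat a.
  apply: (@sharp_unit_intervalP (Gamma_obj R)); split.
    exact: (@clip_ge0 (lru_ring Q) _ (lru_unit_ge0 (lruP Q))).
  exact: (@clip_le (lru_ring Q)).
have [a ea] := clip_hat ((x : lgroup (lru_ring Q)) - lg_unit _ *~ k)%R.
have [b eb] := clip_hat ((y : lgroup (lru_ring Q)) - lg_unit _ *~ k)%R.
rewrite ea eb; congr (sharp_hat _); apply: sig_eq; rewrite -!tauE -ea -eb.
rewrite (lu_hom_clip t) [RHS](lu_hom_clip t).
by rewrite [t x]txy.
Qed.

(** Any [r] is a sum of digits and their opposites, and these are elements of the
    unit interval. *)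
Lemma tau_surj (R : lru) (r : R) : exists x, (tau R : lu_hom _ _) x = r.
Proof.
pose Q : lru := sharp_obj (Gamma_obj R).
pose t : lu_hom (lru_ring Q) (lru_ring R) := tau R.
have: gspan (@Gamma_val R) r.
  apply: (digital_gspan (Gamma_val_map R)); split; first exact: lru_bounded.
  move=> k; set c := clip_at _ _.
  suff Ic : @lunit_interval R c by exists (exist _ c Ic).
  split; first exact: (@clip_ge0 (lru_ring R) _ (lru_unit_ge0 (lruP R))).
  exact: (@clip_le (lru_ring R)).
elim=> [|x a _ [y <-]|x a _ [y <-]].
- by exists lzero; apply: (lu_hom0 t).
- by exists (ladd y (sharp_hat a)); rewrite (lu_homD (tau R)) tauE.
exists (ladd y (lopp (sharp_hat a))); rewrite (lu_homD (tau R)); congr ladd.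
by rewrite [LHS](lu_homN t); congr lopp; apply: tauE.
Qed.

Lemma pmv_bij_iso (A B : PMVf) (h : arr A B) :
  injective (h : pmv_hom A B) -> (forall b, exists a, (h : pmv_hom A B) a = b) ->
  is_iso h.
Proof.
move=> inj surj; pose g b := projT1 (cid (surj b)).
have hg b : (h : pmv_hom A B) (g b) = b := projT2 (cid (surj b)).
unshelve eexists (@PmvHom B A g _ _ _ _).
- by move=> x y; apply: inj; rewrite hg pmv_homD !hg.
- by move=> x; apply: inj; rewrite hg pmv_homN !hg.
- by apply: inj; rewrite hg pmv_hom0.
- by move=> x y; apply: inj; rewrite hg pmv_homM !hg.
by split; apply: pmv_hom_ext => x; [exact: (inj _ _ (hg _)) | exact: (hg x)].
Qed.

Lemma lu_bij_iso (R S : LRu) (h : arr R S) :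
  injective (h : lu_hom R S) -> (forall s, exists r, (h : lu_hom R S) r = s) ->
  is_iso h.
Proof.
move=> inj surj; pose g s := projT1 (cid (surj s)).
have hg s : (h : lu_hom R S) (g s) = s := projT2 (cid (surj s)).
unshelve eexists (@LuHom S R g _ _ _ _ _).
- by move=> x y; apply: inj; rewrite hg lu_homD !hg.
- by move=> x y; apply: inj; rewrite hg lu_homM !hg.
- by move=> x y; apply: inj; rewrite hg lu_hom_meet !hg.
- by move=> x y; apply: inj; rewrite hg lu_hom_join !hg.
- by apply: inj; rewrite hg lu_hom_unit.
by split; apply: lu_hom_ext => x; [exact: (inj _ _ (hg _)) | exact: (hg x)].
Qed.

(* The bound variables GammaP and sharpP say that Gamma(R,u) is a PMV_f-algebra
   and that A^sharp is a semi-low l_u-ring; G and S are the functors Gamma and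
   sharp, determined by the formulas for their actions on morphisms. *)
Theorem theorem5p28 :
  exists (GammaP : forall R : lru, is_pmvf (Gamma_sig R))
         (sharpP : forall A : pmvf, is_lru (sharp_sig A)),
  let Gamma (R : LRu) : PMVf := PMVfAlg (GammaP R) in
  let sharp (A : PMVf) : LRu := LRuRing (sharpP A) in
  exists (G : functor Gamma) (S : functor sharp),
  (forall (R R' : lru) (phi : lu_hom R R') (x : Gamma_sig R),
     sval (pmv_fun (fmap G phi) x) = phi (sval x)) /\
  (forall (A B : pmvf) (h : pmv_hom A B) (s : seq (bool * A)),
     lu_fun (fmap S h) (signed_sum (@sharp_hat A) s)
     = signed_sum (fun a => sharp_hat (h a)) s) /\
  exists (alpha : forall A : PMVf, arr A (Gamma (sharp A)))
         (tau : forall R : LRu, arr (sharp (Gamma R)) R),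
  (forall (A : pmvf) (a : A), sval (pmv_fun (alpha A) a) = sharp_hat a) /\
  (forall (R : lru) (s : seq (bool * Gamma_sig R)),
     lu_fun (tau R) (signed_sum (@sharp_hat (Gamma_sig R)) s)
     = signed_sum (fun x : Gamma_sig R => sval x) s) /\
  (forall A : PMVf, is_iso (alpha A)) /\
  (forall R : LRu, is_iso (tau R)) /\
  natural (functor_id PMVf) (functor_comp G S) alpha /\
  natural (functor_comp S G) (functor_id LRu) tau.
Proof.
exists Gamma_pmvf, sharp_lru => Gamma sharp; exists Gamma_functor, sharp_functor.
have sum_hom (T : Type) (R S : lru) (phi : lu_hom R S) (f : T -> R) (g : T -> S) s :
    (forall x, phi (f x) = g x) -> phi (signed_sum f s) = signed_sum g s.
  move=> fg; rewrite (@lu_hom_signed_sum T (lru_ring R) (lru_ring S)).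
  by congr signed_sum; apply/funext.
split=> //; split.
  move=> A B h s; apply: (sum_hom _ (sharp A) (sharp B)); exact: sharp_homE.
exists alpha, tau; split=> //; split.
  by move=> R s; apply: (sum_hom _ (sharp (Gamma R)) R); exact: tauE.
split; first by move=> A; apply: pmv_bij_iso; [exact: alpha_inj | exact: alpha_surj].
split; first by move=> R; apply: lu_bij_iso; [exact: tau_inj | exact: tau_surj].
split=> [A B h|R R' phi].
  by apply: pmv_hom_ext => a; apply: sig_eq; apply: sharp_homE.
apply: sharp_hom_ext => x /=.
by rewrite tauE sharp_homE tauE.
Qed.
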